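(* Let $A$ be a commutative noetherian ring, let $\mathbf{x} = x_1,\dots,x_n$ be a finite sequence of elements of $A$, and let $M, N$ be $A$-modules (not necessarily finitely generated). Assume that $\mathbf{x}$ is both an $M$-regular sequence and an $N$-regular sequence ($\mathbf{x}$ is not assumed to be $A$-regular). (1) If $\operatorname{Tor}_i^A(M,N) = 0$ for all $i \ge 0$, then $\operatorname{Tor}_i^{A/\mathbf{x}A}(M/\mathbf{x}M, N/\mathbf{x}N) = 0$ for all $i \ge 0$. (2) If $\operatorname{Ext}^i_A(M,N) = 0$ for all $i \ge 0$, then $\operatorname{Ext}^i_{A/\mathbf{x}A}(M/\mathbf{x}M, N/\mathbf{x}N) = 0$ for all $i \ge 0$.
   Context: $\mathbf{x}A$ denotes the ideal $(x_1,\dots,x_n)$ of $A$. A sequence $x_1,\dots,x_n$ is $M$-regular if, for each $1\le j\le n$, multiplication by $x_j$ is injective on $M/(x_1,\dots,x_{j-1})M$. (Some authors also require $M \ne \mathbf{x}M$; this makes no difference to the content of the statement.) *)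

(* Defs.v *)
From HB Require Import structures.
From mathcomp Require Import all_boot all_algebra.
From mathcomp Require Import boolp classical_sets functions cardinality fsbigop.

Set Implicit Arguments.
Unset Strict Implicit.
Unset Printing Implicit Defensive.

Import GRing.Theory.
Local Open Scope ring_scope.
Local Open Scope quotient_scope.

(* Commutative rings are [comPzRingType] rather than [comNzRingType] because
   A/I may be the zero ring.  A submodule of V is an element of
   [submodClosed V]: its membership is boolean, which is no restriction under
   the classical axioms of [boolp]. *)

Section Submodule.
Variables (A : pzRingType) (V : lmodType A) (W : submodClosed V).

Lemma submN v : v \in W -> - v \in W.
Proof. by move=> Wv; rewrite -scaleN1r rpredZ. Qed.

Lemma submB u v : u \in W -> v \in W -> u - v \in W.
Proof. by move=> Wu Wv; rewrite rpredD // submN. Qed.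

Definition subm := {v : V | v \in W}.

HB.instance Definition _ := SubChoice.on subm.
HB.instance Definition _ := [SubChoice_isSubLmodule of subm by <:].

Definition subm_val (v : subm) : V := val v.

Fact subm_val_linear : linear subm_val. Proof. by move=> a u v. Qed.
HB.instance Definition _ :=
  GRing.isLinear.Build A subm V _ subm_val subm_val_linear.

Definition quotm_equiv (u v : V) := u - v \in W.

Fact quotm_equivP : equiv_class_of quotm_equiv.
Proof.
split=> [u|u v|v u w]; rewrite /quotm_equiv ?subrr ?rpred0 //.
  by apply/idP/idP => /submN; rewrite opprB.
by move=> uv vw; rewrite -(subrKA v) rpredD.
Qed.
Canonical quotm_equiv_rel := EquivRelPack quotm_equivP.
Canonical quotm_encModRel := defaultEncModRel quotm_equiv.

Definition quotm := {eq_quot quotm_equiv}.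
HB.instance Definition _ : EqQuotient V quotm_equiv quotm :=
  EqQuotient.on quotm.
HB.instance Definition _ := Choice.on quotm.

Definition quotm_pi (v : V) : quotm := \pi v.

Lemma quotm_piE u v : (quotm_pi u = quotm_pi v) <-> (u - v \in W).
Proof.
rewrite /quotm_pi; split; first by move/eqmodP.
by move=> uv; apply/eqmodP.
Qed.

Lemma quotm_ind (P : quotm -> Prop) : (forall v, P (quotm_pi v)) -> forall q, P q.
Proof. by move=> Ppi q; rewrite -[q]reprK; apply: Ppi. Qed.

Lemma quotm_reprB v : repr (quotm_pi v) - v \in W.
Proof. by apply/quotm_piE; rewrite /quotm_pi reprK. Qed.

Definition quotm_zero := quotm_pi 0.
Definition quotm_opp (q : quotm) := quotm_pi (- repr q).
Definition quotm_add (p q : quotm) := quotm_pi (repr p + repr q).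
Definition quotm_scale (a : A) (q : quotm) := quotm_pi (a *: repr q).

Lemma quotm_oppE v : quotm_opp (quotm_pi v) = quotm_pi (- v).
Proof.
by apply/quotm_piE; rewrite -opprD submN ?quotm_reprB.
Qed.

Lemma quotm_addE u v : quotm_add (quotm_pi u) (quotm_pi v) = quotm_pi (u + v).
Proof. by apply/quotm_piE; rewrite opprD addrACA rpredD // quotm_reprB. Qed.

Lemma quotm_scaleE a v : quotm_scale a (quotm_pi v) = quotm_pi (a *: v).
Proof. by apply/quotm_piE; rewrite -scalerBr rpredZ // quotm_reprB. Qed.

Fact quotm_addA : associative quotm_add.
Proof.
by do 3![elim/quotm_ind=> ?]; rewrite !quotm_addE addrA.
Qed.
Fact quotm_addC : commutative quotm_add.
Proof. by do 2![elim/quotm_ind=> ?]; rewrite !quotm_addE addrC. Qed.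
Fact quotm_add0 : left_id quotm_zero quotm_add.
Proof. by elim/quotm_ind=> ?; rewrite !quotm_addE add0r. Qed.
Fact quotm_addN : left_inverse quotm_zero quotm_opp quotm_add.
Proof. by elim/quotm_ind=> ?; rewrite quotm_oppE quotm_addE addNr. Qed.
HB.instance Definition _ :=
  GRing.isZmodule.Build quotm quotm_addA quotm_addC quotm_add0 quotm_addN.

Lemma quotm_piD u v : quotm_pi (u + v) = quotm_pi u + quotm_pi v.
Proof. by rewrite -quotm_addE. Qed.

Fact quotm_scaleA a b q :
  quotm_scale a (quotm_scale b q) = quotm_scale (a * b) q.
Proof. by elim/quotm_ind: q => ?; rewrite !quotm_scaleE scalerA. Qed.
Fact quotm_scale1 : left_id 1 quotm_scale.
Proof. by elim/quotm_ind=> ?; rewrite quotm_scaleE scale1r. Qed.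
Fact quotm_scaleDr : right_distributive quotm_scale +%R.
Proof.
move=> a; do 2![elim/quotm_ind=> ?].
by rewrite -quotm_piD !quotm_scaleE -quotm_piD scalerDr.
Qed.
Fact quotm_scaleDl q : {morph quotm_scale^~ q : a b / a + b}.
Proof.
elim/quotm_ind: q => ? a b.
by rewrite !quotm_scaleE -quotm_piD scalerDl.
Qed.
HB.instance Definition _ := GRing.Zmodule_isLmodule.Build A quotm
  quotm_scaleA quotm_scale1 quotm_scaleDr quotm_scaleDl.

Fact quotm_pi_linear : linear quotm_pi.
Proof. by move=> a u v; rewrite quotm_piD -quotm_scaleE. Qed.
HB.instance Definition _ :=
  GRing.isLinear.Build A V quotm _ quotm_pi quotm_pi_linear.

End Submodule.

Section KernelImage.
Variables (A : pzRingType) (U V : lmodType A) (f : {linear U -> V}).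

Definition kerm_pred : pred U := fun u => f u == 0.
Fact kerm_closed : subsemimod_closed kerm_pred.
Proof.
split; first split; first by rewrite /in_mem /= /kerm_pred raddf0.
  by move=> u v /eqP fu /eqP fv; apply/eqP; rewrite raddfD /= fu fv addr0.
by move=> a u /eqP fu; apply/eqP; rewrite linearZ /= fu scaler0.
Qed.
Definition kerm : submodClosed U :=
  HB.pack kerm_pred (GRing.isSubmodClosed.Build A U kerm_pred kerm_closed).

Definition imm_pred : pred V := fun v => `[< exists u, f u = v >].
Fact imm_closed : subsemimod_closed imm_pred.
Proof.
split; first split; first by apply/asboolP; exists 0; rewrite raddf0.
  move=> _ _ /asboolP[u <-] /asboolP[v <-]; apply/asboolP.
  by exists (u + v); rewrite raddfD.
move=> a _ /asboolP[u <-]; apply/asboolP.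
by exists (a *: u); rewrite linearZ.
Qed.
Definition imm : submodClosed V :=
  HB.pack imm_pred (GRing.isSubmodClosed.Build A V imm_pred imm_closed).

End KernelImage.

Section Homology.
Variables (A : pzRingType) (U V W : lmodType A).
Variables (f : {linear U -> V}) (g : {linear V -> W}).

(* [homology f g] is ker g / (ker g :&: im f), so that no proof of g \o f = 0
   is needed to form it. *)
Definition imker_pred : pred (subm (kerm g)) := fun v => val v \in imm f.
Fact imker_closed : subsemimod_closed imker_pred.
Proof.
split; first split; first by rewrite /in_mem /= /imker_pred raddf0 rpred0.
  by move=> u v fu fv; rewrite /in_mem /= /imker_pred raddfD rpredD.
by move=> a u fu; rewrite /in_mem /= /imker_pred linearZ rpredZ.
Qed.
Definition imker : submodClosed (subm (kerm g)) :=
  HB.pack imker_pred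
    (GRing.isSubmodClosed.Build A (subm (kerm g)) imker_pred imker_closed).

Definition homology := quotm imker.
HB.instance Definition _ := GRing.Lmodule.on homology.

End Homology.

Definition is_zero_module (A : pzRingType) (V : lmodType A) :=
  forall v : V, v = 0.

Section Generated.
Variables (A : pzRingType) (V : lmodType A) (S : V -> Prop).

Definition genm_pred : pred V := fun v =>
  `[< forall W : submodClosed V, (forall s, S s -> s \in W) -> v \in W >].
Fact genm_closed : subsemimod_closed genm_pred.
Proof.
split; first split; first by apply/asboolP => W _; exact: rpred0.
  move=> u v /asboolP Su /asboolP Sv; apply/asboolP => W SW.
  by rewrite rpredD ?Su ?Sv.
by move=> a v /asboolP Sv; apply/asboolP => W SW; rewrite rpredZ ?Sv.
Qed.
Definition genm : submodClosed V :=
  HB.pack genm_pred (GRing.isSubmodClosed.Build A V genm_pred genm_closed).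

Lemma genm_sub s : S s -> s \in genm.
Proof. by move=> Ss; apply/asboolP => W; apply. Qed.

End Generated.

(* The free module on X, realized as the functions X -> A of finite support;
   [freem_single x] is the basis element attached to x. *)
Section Free.
Variables (A : pzRingType) (X : choiceType).

Definition finsupp_pred : pred (X -> A^o) :=
  fun f => `[< finite_set [set x | f x != 0] >].
Fact finsupp_closed : subsemimod_closed finsupp_pred.
Proof.
split; first split.
- apply/asboolP; apply: (sub_finite_set (B := set0)) => // x /=.
  by rewrite eqxx.
- move=> f g /asboolP ff /asboolP fg; apply/asboolP.
  apply: (sub_finite_set (B := [set x | f x != 0] `|` [set x | g x != 0])%classic).
    move=> x /=; rewrite addrfctE; case: (eqVneq (f x) 0) => [->|_]; last by left.
    by rewrite add0r; right.
  by rewrite finite_setU.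
- move=> a f /asboolP ff; apply/asboolP; apply: sub_finite_set ff => x /=.
  rewrite scalrfctE; apply: contra_neq => ->.
  exact: mulr0.
Qed.
Definition finsupp : submodClosed (X -> A^o) :=
  HB.pack finsupp_pred
    (GRing.isSubmodClosed.Build A (X -> A^o) finsupp_pred finsupp_closed).

Definition freem := subm finsupp.
HB.instance Definition _ := GRing.Lmodule.on freem.

Fact single_finsupp (x : X) : (fun y => (y == x)%:R : A^o) \in finsupp.
Proof.
apply/asboolP; apply: (sub_finite_set (B := [set x]%classic)) => // y /=.
by case: (y =P x) => // _; rewrite mulr0n eqxx.
Qed.
Definition freem_single (x : X) : freem :=
  exist (fun f => f \in finsupp) _ (single_finsupp x).

Definition freem_coef (f : freem) (x : X) : A := val f x.

Lemma freem_coef_single x y : freem_coef (freem_single x) y = (y == x)%:R.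
Proof. by []. Qed.

Lemma freem_coef_linear a (f h : freem) x :
  freem_coef (a *: f + h) x = a * freem_coef f x + freem_coef h x.
Proof. by []. Qed.

Lemma freem_coef_finite (f : freem) : finite_set [set x | freem_coef f x != 0].
Proof. exact: asboolW (valP f). Qed.

Variables (V : lmodType A) (g : X -> V).

Definition freem_lift (f : freem) : V :=
  \sum_(x \in [set: X]) freem_coef f x *: g x.

Lemma freem_liftE (f : freem) (D : set X) : finite_set D ->
  (forall x, freem_coef f x != 0 -> D x) ->
  freem_lift f = \sum_(x \in D) freem_coef f x *: g x.
Proof.
move=> _ fD; rewrite /freem_lift; apply/esym/fsbig_widen => // x [_ /= nDx].
by case: (eqVneq (freem_coef f x) 0) => [->|/fD//]; rewrite scale0r.
Qed.

Fact freem_lift_linear : linear freem_lift.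
Proof.
move=> a f h.
pose D :=
  ([set x | freem_coef f x != 0%R] `|` [set x | freem_coef h x != 0%R])%classic.
have fD : finite_set D by rewrite finite_setU; split; apply: freem_coef_finite.
rewrite !(freem_liftE (D := D)) //.
- rewrite !fsbig_finite //= scaler_sumr -big_split /=.
  by apply: eq_bigr => x _; rewrite freem_coef_linear scalerDl scalerA.
- by move=> x; right.
- by move=> x; left.
move=> x /=; case: (eqVneq (freem_coef f x) 0) => [fx0|fx0]; last by left.
move=> hx0; right => /=; apply: contra_neq hx0 => hx0.
by rewrite freem_coef_linear fx0 hx0 mulr0 addr0.
Qed.
HB.instance Definition _ :=
  GRing.isLinear.Build A freem V _ freem_lift freem_lift_linear.

Lemma freem_lift_single x : freem_lift (freem_single x) = g x.
Proof.
rewrite (freem_liftE (D := [set x]%classic)) //; last first.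
  by move=> y /=; rewrite freem_coef_single; case: (y =P x) => // _; rewrite eqxx.
by rewrite fsbig_set1 freem_coef_single eqxx scale1r.
Qed.

End Free.

(* The standard free resolution of M: [syzygy] iterates V |-> ker (A^(V) -> V),
   where A^(V) = [freem A V] is free on the underlying set of V, and the
   complex is ... -> res 1 -> res 0, augmented by [aug M : res 0 -> M].  Its
   exactness is [aug_surj], [imm_res_d] (at i = 0) and [res_exact]. *)
Section Resolution.
Variables (A : pzRingType) (M : lmodType A).

Definition aug (V : lmodType A) : {linear freem A V -> V} :=
  freem_lift (fun v : V => v).

Fixpoint syzygy (i : nat) : lmodType A :=
  if i is j.+1 then subm (kerm (aug (syzygy j))) else M.

Definition res (i : nat) : lmodType A := freem A (syzygy i).

Definition res_d (i : nat) : {linear res i.+1 -> res i} :=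
  subm_val (W := kerm (aug (syzygy i))) \o aug (syzygy i.+1).

Lemma aug_surj (V : lmodType A) v : exists f, aug V f = v.
Proof. by exists (freem_single A v); exact: freem_lift_single. Qed.

Lemma imm_res_d i : imm (res_d i) =i kerm (aug (syzygy i)).
Proof.
move=> u; apply/asboolP/idP => [[f <-]|ku]; first exact: valP.
by have [f fu] := aug_surj (exist _ u ku : syzygy i.+1); exists f; rewrite /= fu.
Qed.

Lemma res_exact i : kerm (res_d i) =i imm (res_d i.+1).
Proof.
move=> u; rewrite imm_res_d; apply/eqP/eqP; last first.
  by rewrite /res_d /= => ->; rewrite raddf0.
by move=> u0; apply: val_inj; rewrite raddf0.
Qed.

End Resolution.

Section Tensor.
Variables (A : comPzRingType) (M N : lmodType A).

Local Notation e m n := (freem_single A (m, n)).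

Inductive tens_rel : freem A (M * N)%type -> Prop :=
| TensDl m1 m2 n : tens_rel (e (m1 + m2) n - (e m1 n + e m2 n))
| TensDr m n1 n2 : tens_rel (e m (n1 + n2) - (e m n1 + e m n2))
| TensZl a m n : tens_rel (e (a *: m) n - a *: e m n)
| TensZr a m n : tens_rel (e m (a *: n) - a *: e m n).

Definition tens := quotm (genm tens_rel).
HB.instance Definition _ := GRing.Lmodule.on tens.

Definition pure (m : M) (n : N) : tens := quotm_pi _ (e m n).

Fact pure_linearl n : linear (pure^~ n).
Proof.
move=> a u v; rewrite /pure; have D := genm_sub (TensDl (a *: u) v n).
have Z := genm_sub (TensZl a u n).
move/quotm_piE: D => ->; move/quotm_piE: Z => Z.
by rewrite quotm_piD Z linearZ.
Qed.

Fact pure_linearr m : linear (pure m).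
Proof.
move=> a u v; rewrite /pure; have D := genm_sub (TensDr m (a *: u) v).
have Z := genm_sub (TensZr a m u).
move/quotm_piE: D => ->; move/quotm_piE: Z => Z.
by rewrite quotm_piD Z linearZ.
Qed.

Section Lift.
Variables (P : lmodType A) (b : M -> N -> P).
Hypotheses (bl : forall n, linear (b^~ n)) (br : forall m, linear (b m)).

Let g (p : M * N) := b p.1 p.2.

Fact tens_rel_kerm t : t \in genm tens_rel -> t \in kerm (freem_lift g).
Proof.
have lin0 (V : lmodType A) (h : V -> P) : linear h -> h 0 = 0.
  by move=> hl; have := hl (-1) 0 0; rewrite scaler0 addr0 scaleN1r addNr.
have linD (V : lmodType A) (h : V -> P) u v : linear h -> h (u + v) = h u + h v.
  by move=> hl; have := hl 1 u v; rewrite !scale1r.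
have linZ (V : lmodType A) (h : V -> P) a u : linear h -> h (a *: u) = a *: h u.
  by move=> hl; have := hl a u 0; rewrite (lin0 _ h hl) !addr0.
move/asboolW; apply=> s sr; apply/eqP; case: sr => [m1 m2 n|m n1 n2|a m n|a m n].
- rewrite linearB linearD /= !freem_lift_single /g /=.
  by rewrite (linD _ (b^~ n)) ?subrr.
- rewrite linearB linearD /= !freem_lift_single /g /=.
  by rewrite (linD _ (b m)) ?subrr.
- rewrite linearB linearZ /= !freem_lift_single /g /=.
  by rewrite (linZ _ (b^~ n)) ?subrr.
- rewrite linearB linearZ /= !freem_lift_single /g /=.
  by rewrite (linZ _ (b m)) ?subrr.
Qed.

Definition tens_lift (t : tens) : P := freem_lift g (repr t).

Fact tens_lift_pi f : tens_lift (quotm_pi _ f) = freem_lift g f.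
Proof.
by apply/eqP; rewrite -subr_eq0 -raddfB; apply/tens_rel_kerm/quotm_reprB.
Qed.

Lemma tens_liftE m n : tens_lift (pure m n) = b m n.
Proof. by rewrite tens_lift_pi freem_lift_single. Qed.

Fact tens_lift_linear : linear tens_lift.
Proof.
move=> a; elim/quotm_ind=> u; elim/quotm_ind=> v.
by rewrite -linearP /= !tens_lift_pi linearP.
Qed.

End Lift.
End Tensor.

Section TensorMap.
Variables (A : comPzRingType) (M M' N : lmodType A) (f : {linear M -> M'}).

Definition tens_map : tens M N -> tens M' N :=
  tens_lift (fun (m : M) (n : N) => pure (f m) n).

Fact tens_map_bl (n : N) : linear (fun m => pure (f m) n).
Proof. by move=> a u v; rewrite linearP pure_linearl. Qed.

Fact tens_map_linear : linear tens_map.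
Proof. exact: tens_lift_linear tens_map_bl (fun m => pure_linearr (f m)). Qed.
HB.instance Definition _ := GRing.isLinear.Build A _ _ _ tens_map tens_map_linear.

Lemma tens_mapE m n : tens_map (pure m n) = pure (f m) n.
Proof.
exact: tens_liftE tens_map_bl (fun m => pure_linearr (f m)) m n.
Qed.

End TensorMap.
Arguments tens_map {A M M'} N f.

Section Hom.
Variables (A : comPzRingType) (M N : lmodType A).

Definition homm_pred : pred (M -> N) := fun f => `[< linear f >].
Fact homm_closed : subsemimod_closed homm_pred.
Proof.
split; first split.
- by apply/asboolP => a u v; rewrite scaler0 addr0.
- move=> f g /asboolP fl /asboolP gl; apply/asboolP => a u v.
  by rewrite !addrfctE fl gl scalerDr addrACA.
- move=> c f /asboolP fl; apply/asboolP => a u v.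
  by rewrite !scalrfctE fl scalerDr !scalerA mulrC.
Qed.
Definition homm_sub : submodClosed (M -> N) :=
  HB.pack homm_pred
    (GRing.isSubmodClosed.Build A (M -> N) homm_pred homm_closed).

Definition homm := subm homm_sub.
HB.instance Definition _ := GRing.Lmodule.on homm.

End Hom.

Section HomMap.
Variables (A : comPzRingType) (M M' N : lmodType A) (f : {linear M' -> M}).

Fact homm_map_subproof (h : homm M N) : (val h \o f : M' -> N) \in homm_sub M' N.
Proof.
have hl : linear (val h) := asboolW (valP h).
by apply/asboolP => a u v /=; rewrite linearP hl.
Qed.
Definition homm_map (h : homm M N) : homm M' N :=
  exist (fun h => h \in homm_sub M' N) _ (homm_map_subproof h).

Fact homm_map_linear : linear homm_map.
Proof. by move=> a u v; apply: val_inj. Qed.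
HB.instance Definition _ := GRing.isLinear.Build A _ _ _ homm_map homm_map_linear.

End HomMap.
Arguments homm_map {A M M'} N f.

(* Tor and Ext are computed on the standard free resolution of the first
   argument; any projective resolution gives the same modules up to
   isomorphism. *)
Section TorExt.
Variables (A : comPzRingType).

Definition chain_homology (C : nat -> lmodType A)
    (d : forall i, {linear C i.+1 -> C i}) (i : nat) : lmodType A :=
  if i is j.+1 then homology (d j.+1) (d j) else quotm (imm (d 0%N)).

Definition cochain_homology (C : nat -> lmodType A)
    (d : forall i, {linear C i -> C i.+1}) (i : nat) : lmodType A :=
  if i is j.+1 then homology (d j) (d j.+1) else subm (kerm (d 0%N)).

Definition Tor (i : nat) (M N : lmodType A) : lmodType A :=
  chain_homology (fun j => tens_map N (res_d M j)) i.

Definition Ext (i : nat) (M N : lmodType A) : lmodType A :=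
  cochain_homology (fun j => homm_map N (res_d M j)) i.

End TorExt.

Section Ideals.
Variables (A : comPzRingType).

Definition ideal (s : seq A) : submodClosed A^o := genm (fun a : A^o => a \in s).

Definition noetherian :=
  forall I : submodClosed A^o, exists s : seq A, I =i ideal s.

Definition idealm (I : submodClosed A^o) (M : lmodType A) : submodClosed M :=
  genm (fun v : M => exists a : A, exists m : M, a \in I /\ v = a *: m).

(* x_1, ..., x_n are the entries 0, ..., n - 1 of x, so [take j x] lists the
   elements preceding [x`_j]; M <> xM is not required. *)
Definition regular_seq (M : lmodType A) (x : seq A) :=
  forall j, (j < size x)%N ->
    injective (fun m : quotm (idealm (ideal (take j x)) M) => x`_j *: m).

End Ideals.

Section QuotientRing.
Variables (A : comPzRingType) (I : submodClosed A^o).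

Definition quotr := quotm I.
HB.instance Definition _ := GRing.Zmodule.on quotr.

Definition quotr_pi (a : A) : quotr := quotm_pi I a.
Definition quotr_one := quotr_pi 1.
Definition quotr_mul (p q : quotr) : quotr := quotr_pi (repr p * repr q).

Lemma quotr_ind (P : quotr -> Prop) : (forall a, P (quotr_pi a)) -> forall q, P q.
Proof. by move=> Ppi q; rewrite -[q]reprK; apply: Ppi. Qed.

Lemma quotr_mulE a b : quotr_mul (quotr_pi a) (quotr_pi b) = quotr_pi (a * b).
Proof.
apply: (iffRL (quotm_piE I _ _)); rewrite -(subrKA (repr (quotr_pi a) * b)) -mulrBr -mulrBl.
rewrite (mulrC _ b) rpredD //; exact: rpredZ (quotm_reprB _ _).
Qed.

Lemma quotr_piD a b : quotr_pi (a + b) = quotr_pi a + quotr_pi b.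
Proof. exact: quotm_piD. Qed.

Fact quotr_mulA : associative quotr_mul.
Proof. by do 3![elim/quotr_ind=> ?]; rewrite !quotr_mulE mulrA. Qed.
Fact quotr_mulC : commutative quotr_mul.
Proof. by do 2![elim/quotr_ind=> ?]; rewrite !quotr_mulE mulrC. Qed.
Fact quotr_mul1 : left_id quotr_one quotr_mul.
Proof. by elim/quotr_ind=> ?; rewrite quotr_mulE mul1r. Qed.
Fact quotr_mulDl : left_distributive quotr_mul +%R.
Proof.
do 3![elim/quotr_ind=> ?].
by rewrite -quotr_piD !quotr_mulE mulrDl quotr_piD.
Qed.
HB.instance Definition _ := GRing.Zmodule_isComPzRing.Build quotr
  quotr_mulA quotr_mulC quotr_mul1 quotr_mulDl.

Lemma quotr_piM a b : quotr_pi (a * b) = quotr_pi a * quotr_pi b.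
Proof. by rewrite -quotr_mulE. Qed.

End QuotientRing.

(* M/IM as a module over A/I. *)
Section ReducedModule.
Variables (A : comPzRingType) (I : submodClosed A^o) (M : lmodType A).

Definition redm := quotm (idealm I M).
HB.instance Definition _ := GRing.Zmodule.on redm.

Definition redm_pi (m : M) : redm := quotm_pi (idealm I M) m.
Definition redm_scale (a : quotr I) (q : redm) : redm := redm_pi (repr a *: repr q).

Lemma redm_ind (P : redm -> Prop) : (forall m, P (redm_pi m)) -> forall q, P q.
Proof. by move=> Ppi q; rewrite -[q]reprK; apply: Ppi. Qed.

Lemma redm_piD m n : redm_pi (m + n) = redm_pi m + redm_pi n.
Proof. exact: quotm_piD. Qed.

Lemma redm_scaleE a m : redm_scale (quotr_pi I a) (redm_pi m) = redm_pi (a *: m).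
Proof.
apply: (iffRL (quotm_piE (idealm I M) _ _)).
rewrite -(subrKA (repr (quotr_pi I a) *: m)) -scalerBr -scalerBl.
rewrite rpredD //; first exact: rpredZ (quotm_reprB _ _).
apply: genm_sub.
exists (repr (quotr_pi I a) - a), m; split=> //; exact: (quotm_reprB I a).
Qed.

Fact redm_scaleA a b q : redm_scale a (redm_scale b q) = redm_scale (a * b) q.
Proof.
elim/quotr_ind: a => a; elim/quotr_ind: b => b; elim/redm_ind: q => m.
by rewrite -quotr_piM !redm_scaleE scalerA.
Qed.
Fact redm_scale1 : left_id 1 redm_scale.
Proof. by elim/redm_ind=> m; rewrite redm_scaleE scale1r. Qed.
Fact redm_scaleDr : right_distributive redm_scale +%R.
Proof.
elim/quotr_ind=> a; do 2![elim/redm_ind=> ?].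
by rewrite -redm_piD !redm_scaleE scalerDr redm_piD.
Qed.
Fact redm_scaleDl q : {morph redm_scale^~ q : a b / a + b}.
Proof.
elim/redm_ind: q => m; do 2![elim/quotr_ind=> ?].
by rewrite -quotr_piD !redm_scaleE scalerDl redm_piD.
Qed.
HB.instance Definition _ := GRing.Zmodule_isLmodule.Build (quotr I) redm
  redm_scaleA redm_scale1 redm_scaleDr redm_scaleDl.

End ReducedModule.

(* Main.v *)
Require Import Defs.
From HB Require Import structures.
From mathcomp Require Import all_boot all_algebra.
From mathcomp Require Import boolp classical_sets functions cardinality fsbigop.

(* Let I = xA, B = A/I, U = M/xM, V = N/xN, and let T be - (x) V or Hom(-, V).
   Long exact sequences along the regular sequences show that the derived
   functors of T over A vanish on U.  To descend to B, let Y be a nonnegative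
   complex of projective B-modules on which the derived functors of T over A
   vanish, for instance a resolution of U, and let R -> Y be a resolution by
   projective A-modules, so that T(R) is exact.  Since I V = 0, T(R/IR) = T(R),
   so T(Y) is exact as soon as T(Y') is, where Y' = cone(R/IR -> Y).  The
   derived functors of T over A vanish on Y' as well: Y' is the quotient of the
   exact complex cone(R -> Y) by IR[1] = (R (x) I)[1], and dimension shifting in
   W shows that they vanish on R (x) W for every module W.  Finally, if Y is
   exact in degrees < k then Y' is exact in degrees <= k; after n steps one
   reaches a complex which is exact, hence contractible, in degrees < n.

   Complexes are indexed by nat and vanish at index 0; thus a module is placed
   at index 1, and exactness "at i" refers to the term of index i + 1. *)

Set Implicit Arguments.
Unset Strict Implicit.
Unset Printing Implicit Defensive.

Import GRing.Theory.
Local Open Scope ring_scope.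

(** * Complexes *)

Definition lin_of (A : pzRingType) (U V : lmodType A) (f : U -> V)
    (fl : linear f) : {linear U -> V} :=
  HB.pack f (GRing.isLinear.Build A U V _ f fl).

Section PairInjections.
Variables (A : pzRingType) (X Y : lmodType A).

Fact inl_linear : linear (fun x : X => (x, 0 : Y)).
Proof. by move=> a u v; congr pair; rewrite /= scaler0 addr0. Qed.
Fact inr_linear : linear (fun y : Y => (0 : X, y)).
Proof. by move=> a u v; congr pair; rewrite /= scaler0 addr0. Qed.

Definition inlm : {linear X -> (X * Y)%type} := lin_of inl_linear.
Definition inrm : {linear Y -> (X * Y)%type} := lin_of inr_linear.

Lemma pairE (c : (X * Y)%type) : c = inlm c.1 + inrm c.2.
Proof. by case: c => x y; congr pair; rewrite /= ?addr0 ?add0r. Qed.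

End PairInjections.

Section Complexes.
Variable A : pzRingType.

Definition zerom : lmodType A := 'rV[A]_0.

Lemma zeromE (v : zerom) : v = 0. Proof. exact: thinmx0. Qed.

Record cplx := Cplx {
  obj :> nat -> lmodType A;
  dif : forall i, {linear obj i.+1 -> obj i};
  difK : forall i x, dif i (dif i.+1 x) = 0;
  obj0 : forall x : obj 0%N, x = 0 }.

(** At i = 0 every c qualifies, because [C 0] vanishes; the condition then says that [dif C 1] is
    onto. *)
Definition ex_at (C : cplx) i :=
  forall c : C i.+1, dif C i c = 0 -> exists b, dif C i.+1 b = c.

Record chmap (X Y : cplx) := Chmap {
  cmap :> forall i, {linear X i -> Y i};
  cmapE : forall i x, dif Y i (cmap i.+1 x) = cmap i (dif X i x) }.

Definition zeroc : cplx :=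
  @Cplx (fun=> zerom) (fun=> \0) (fun _ _ => erefl) zeromE.

Section Shift.
Variable X : cplx.

Definition shift_obj i : lmodType A := if i is j.+1 then X j else zerom.

Definition shift_dif i : {linear shift_obj i.+1 -> shift_obj i} :=
  match i with 0%N => \0 | j.+1 => \- dif X j end.

Fact shift_difK i x : shift_dif i (shift_dif i.+1 x) = 0.
Proof. by case: i x => [//|i] x /=; rewrite raddfN /= difK !oppr0. Qed.

Definition shift : cplx := Cplx shift_difK zeromE.

End Shift.

Definition shift_map (X Y : cplx) (f : forall i, {linear X i -> Y i}) i :
    {linear shift X i -> shift Y i} :=
  match i with 0%N => \0 | j.+1 => f j end.

Section Cone.
Variables (X Y : cplx) (f : chmap X Y).

Definition cone_obj i : lmodType A := (Y i * shift X i)%type.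

Definition cone_fun i (c : cone_obj i.+1) : cone_obj i :=
  (dif Y i c.1 + f i c.2, dif (shift X) i c.2).

Fact cone_linear i : linear (@cone_fun i).
Proof.
move=> a u v; rewrite /cone_fun /= !linearP.
by congr pair; rewrite /= scalerDr addrACA.
Qed.

Definition cone_dif i : {linear cone_obj i.+1 -> cone_obj i} :=
  lin_of (@cone_linear i).

Fact cone_difK i x : cone_dif i (cone_dif i.+1 x) = 0.
Proof.
case: x => y x; congr pair; last exact: (difK (c := shift X)).
by rewrite /= raddfD /= difK add0r raddfN /= cmapE subrr.
Qed.

Fact cone_obj0 (x : cone_obj 0%N) : x = 0.
Proof. by case: x => y x; rewrite (obj0 y) (zeromE x). Qed.

Definition cone : cplx := Cplx cone_difK cone_obj0.

Lemma cone_inlE i y : dif cone i (inlm _ _ y) = inlm _ _ (dif Y i y).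
Proof. by congr pair; rewrite /= ?raddf0 ?addr0. Qed.

End Cone.

(** * Relative projectivity and homotopies *)

Section Lifting.
Variable K : lmodType A -> Prop.

(** Lifting is tested only on modules of a class K: all modules for projectivity over A, those
    killed by I for projectivity over A/I, which is thus expressed inside A-modules. The image of p
    only has to contain that of f. *)
Definition projm (P : lmodType A) := forall (X Y : lmodType A)
    (p : {linear X -> Y}) (f : {linear P -> Y}), K X -> K Y ->
  (forall u, exists x, p x = f u) -> exists g : {linear P -> X}, forall u, p (g u) = f u.

Lemma projm_zero : projm zerom.
Proof.
by move=> X Y p f _ _ _; exists \0 => u; rewrite (zeromE u) !raddf0.
Qed.

Lemma projm_prod P Q : projm P -> projm Q -> projm (P * Q)%type.
Proof.
move=> pP pQ X Y p f KX KY fp.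
have [|g gE] := pP X Y p (f \o inlm P Q) KX KY; first by move=> u; exact: fp.
have [|h hE] := pQ X Y p (f \o inrm P Q) KX KY; first by move=> u; exact: fp.
exists ((g \o fst) \+ (h \o snd)) => c.
by rewrite [in RHS](pairE c) !raddfD /= gE hE.
Qed.

(* The homotopy is built degree by degree: the error of the part already
   constructed is a cycle, hence liftable. *)
Lemma homotopy (R E : cplx) (f : chmap R E) :
  (forall i, projm (R i)) -> (forall i, K (E i)) ->
  exists h : forall i, {linear R i -> E i.+1},
    forall i, (forall j, (j <= i)%N -> ex_at E j) ->
      forall x, f i.+1 x = dif E i.+1 (h i.+1 x) + h i (dif R i x).
Proof.
move=> pR KE.
pose ok i (h : {linear R i -> E i.+1}) (h' : {linear R i.+1 -> E i.+2}) :=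
  forall x, f i.+1 x = dif E i.+1 (h' x) + h (dif R i x).
(* The homotopy is defined in every degree, with 0 as default where no continuation exists, so that
   a single h serves every range in which E is exact. *)
pose nxt i h := if pselect (exists h', @ok i h h') is left e then projT1 (cid e) else \0.
pose h := fix h i : {linear R i -> E i.+1} :=
  match i with 0%N => \0 | j.+1 => nxt j (h j) end.
have nxtP i h0 : (exists h', @ok i h0 h') -> ok _ h0 (nxt i h0).
  by move=> e; rewrite /nxt; case: pselect => // e'; exact: projT2 (cid e').
exists h; elim=> [|i IHi] exE; apply: nxtP.
  have [|g gE] := pR 1%N _ _ (dif E 1) (f 1%N) (KE _) (KE _).
    by move=> u; apply: (exE 0%N) => //; exact: obj0.
  by exists g => x; rewrite gE addr0.
have {}IHi := IHi (fun j ji => exE j (leqW ji)).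
have [|g gE] := pR i.+2 _ _ (dif E i.+2) (f i.+2 \- (h i.+1 \o dif R i.+1)) (KE _) (KE _).
  move=> u; apply: exE => //.
  by rewrite /= raddfB /= cmapE IHi difK raddf0 addr0 subrr.
by exists g => x; rewrite gE /= subrK.
Qed.

End Lifting.
End Complexes.

(** * Free modules and tensor products *)

Section FreeLemmas.
Variables (A : pzRingType) (X : choiceType).

Lemma freem_lift_comp (V W : lmodType A) (h : {linear V -> W}) (g : X -> V) f :
  h (freem_lift g f) = freem_lift (h \o g) f.
Proof.
have fD := freem_coef_finite f.
rewrite !(@freem_liftE _ _ _ _ f [set x | freem_coef f x != 0%R]%classic) //.
by rewrite !fsbig_finite //= raddf_sum; apply: eq_bigr => x _ /=; rewrite linearZ.
Qed.

Fact freem_coef_lin (x : X) : linear (fun f : freem A X => freem_coef f x : A^o).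
Proof. by []. Qed.

Lemma freem_lift_singles (f : freem A X) : freem_lift (freem_single A (X := X)) f = f.
Proof.
apply: val_inj; apply: funext => y.
rewrite -[LHS]/(lin_of (freem_coef_lin y) _) freem_lift_comp.
rewrite /freem_lift -(@fsbig_widen _ _ _ _ [set y]%classic) //; last first.
  move=> x [_ /= /eqP yx]; rewrite freem_coef_single [y == x]eq_sym (negPf yx).
  exact: scaler0.
rewrite fsbig_set1 /= freem_coef_single eqxx; exact: mulr1.
Qed.

Lemma freem_ext (V : lmodType A) (h k : {linear freem A X -> V}) :
  (forall x, h (freem_single A x) = k (freem_single A x)) -> forall f, h f = k f.
Proof.
move=> hk f; rewrite -[f]freem_lift_singles !freem_lift_comp.
by congr (freem_lift _ f); apply: funext => x /=.
Qed.

Lemma projm_freem (K : lmodType A -> Prop) : projm K (freem A X).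
Proof.
move=> U V p f _ _ fp.
have [g gE] := choice (fun x => fp (freem_single A x)).
exists (freem_lift g) => u.
by apply: (freem_ext (h := p \o freem_lift g)) => x /=; rewrite freem_lift_single gE.
Qed.

End FreeLemmas.

Lemma freem_lift_linear2 (A : comPzRingType) (X : choiceType) (V : lmodType A) a
    (g h : X -> V) f :
  freem_lift (fun x => a *: g x + h x) f = a *: freem_lift g f + freem_lift h f.
Proof.
have fD := freem_coef_finite f.
rewrite !(@freem_liftE _ _ _ _ f [set x | freem_coef f x != 0%R]%classic) //.
rewrite !fsbig_finite //= scaler_sumr -big_split /=; apply: eq_bigr => x _.
by rewrite scalerDr !scalerA mulrC.
Qed.

Section TensorLemmas.
Variable A : comPzRingType.
Implicit Types M N P R W : lmodType A.

Lemma tens_ext M N P (h k : {linear tens M N -> P}) :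
  (forall m n, h (pure m n) = k (pure m n)) -> forall t, h t = k t.
Proof.
move=> hk; elim/quotm_ind => f.
have /= := @freem_ext _ _ _ (h \o quotm_pi (genm (@tens_rel A M N)))
  (k \o quotm_pi (genm (@tens_rel A M N))).
by apply=> -[m n]; exact: hk.
Qed.

Definition tens_lin M N P (b : M -> N -> P) (bl : forall n, linear (b^~ n))
    (br : forall m, linear (b m)) : {linear tens M N -> P} :=
  lin_of (tens_lift_linear bl br).

Lemma tens_linE M N P (b : M -> N -> P) bl br m n :
  @tens_lin M N P b bl br (pure m n) = b m n.
Proof. exact: tens_liftE. Qed.

Fact tens_map2_bl R W W' (g : {linear W -> W'}) w :
  linear (fun r : R => pure r (g w)).
Proof. exact: pure_linearl. Qed.

Fact tens_map2_br R W W' (g : {linear W -> W'}) (r : R) :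
  linear (fun w => pure r (g w)).
Proof. by move=> a u v; rewrite linearP pure_linearr. Qed.

Definition tens_map2 R W W' (g : {linear W -> W'}) : tens R W -> tens R W' :=
  tens_lift (fun r w => pure r (g w)).
Arguments tens_map2 R {W W'} g.

Fact tens_map2_linear R W W' g : linear (@tens_map2 R W W' g).
Proof. exact: tens_lift_linear (tens_map2_bl g) (tens_map2_br g). Qed.
HB.instance Definition _ R W W' g :=
  GRing.isLinear.Build A _ _ _ (@tens_map2 R W W' g) (tens_map2_linear g).

Lemma tens_map2E R W W' (g : {linear W -> W'}) (r : R) w :
  tens_map2 R g (pure r w) = pure r (g w).
Proof. exact: tens_liftE (tens_map2_bl g) (tens_map2_br g) r w. Qed.

Lemma pureDl M N (m m' : M) (n : N) : pure (m + m') n = pure m n + pure m' n.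
Proof. by rewrite -[m]scale1r pure_linearl !scale1r. Qed.

Lemma pure0l M N (n : N) : pure (0 : M) n = 0.
Proof. by apply: (addrI (pure 0 n)); rewrite -pureDl !addr0. Qed.

Lemma pureZl M N a (m : M) (n : N) : pure (a *: m) n = a *: pure m n.
Proof. by rewrite -[a *: m]addr0 pure_linearl pure0l addr0. Qed.

Lemma pureDr M N (m : M) (n n' : N) : pure m (n + n') = pure m n + pure m n'.
Proof. by rewrite -[n]scale1r pure_linearr !scale1r. Qed.

Lemma pure0r M N (m : M) : pure m (0 : N) = 0.
Proof. by apply: (addrI (pure m 0)); rewrite -pureDr !addr0. Qed.

Lemma pureZr M N a (m : M) (n : N) : pure m (a *: n) = a *: pure m n.
Proof. by rewrite -[a *: n]addr0 pure_linearr pure0r addr0. Qed.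

Lemma tens_map_comp M M' M'' N (f : {linear M -> M'}) (g : {linear M' -> M''}) t :
  tens_map N g (tens_map N f t) = tens_map N (g \o f) t.
Proof.
apply: (tens_ext (h := tens_map N g \o tens_map N f)) => m n.
by rewrite /= !tens_mapE.
Qed.

Lemma tens_mapD M M' N (f g : {linear M -> M'}) t :
  tens_map N (f \+ g) t = tens_map N f t + tens_map N g t.
Proof.
apply: (tens_ext (k := tens_map N f \+ tens_map N g)) => m n.
by rewrite /= !tens_mapE /= pureDl.
Qed.

Lemma tens_map_id M N (t : tens M N) : tens_map N idfun t = t.
Proof. by apply: (tens_ext (k := idfun)) => m n; rewrite /= tens_mapE. Qed.

Lemma eq_tens_map M M' N (f g : {linear M -> M'}) : f =1 g -> tens_map N f =1 tens_map N g.
Proof. by move=> fg; apply: tens_ext => m n; rewrite /= !tens_mapE fg. Qed.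

Lemma tens_map0 M M' N (f : {linear M -> M'}) t : (forall m, f m = 0) -> tens_map N f t = 0.
Proof.
by move=> f0; apply: (tens_ext (k := \0)) => m n; rewrite /= tens_mapE f0 pure0l.
Qed.

Lemma tens_map2_comp M N N' N'' (f : {linear N -> N'}) (g : {linear N' -> N''}) t :
  tens_map2 M g (tens_map2 M f t) = tens_map2 M (g \o f) t.
Proof.
apply: (tens_ext (h := tens_map2 M g \o tens_map2 M f)) => m n.
by rewrite /= !tens_map2E.
Qed.

Lemma tens_map_map2 M M' N N' (f : {linear M -> M'}) (g : {linear N -> N'}) t :
  tens_map N' f (tens_map2 M g t) = tens_map2 M' g (tens_map N f t).
Proof.
apply: (tens_ext (h := tens_map N' f \o tens_map2 M g) (k := tens_map2 M' g \o tens_map N f)) => m n.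
by rewrite /= !(tens_map2E, tens_mapE).
Qed.

Lemma tens_ind M N (Q : tens M N -> Prop) :
  Q 0 -> (forall s t, Q s -> Q t -> Q (s + t)) -> (forall m n, Q (pure m n)) ->
  forall t, Q t.
Proof.
move=> Q0 QD Qp; elim/quotm_ind => f; rewrite -[f]freem_lift_singles.
have fD := freem_coef_finite f.
rewrite (@freem_liftE _ _ _ _ f [set x | freem_coef f x != 0%R]%classic) //.
rewrite fsbig_finite //= raddf_sum; elim/big_ind: _ => // -[m n] _.
by rewrite [X in Q X](_ : _ = pure (freem_coef f (m, n) *: m) n) // pureZl; exact: linearZ.
Qed.

(** For exactness in the middle, let s be a set-theoretic section of p. Two lifts of the same v
    differ by an element of im i, so r (x) v |-> r (x) s(v) is bilinear with values in coker(R (x)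
    i). Composed with R (x) p it is the projection onto this cokernel. *)
Lemma tens_right_exact R W W' W'' (i : {linear W' -> W}) (p : {linear W -> W''}) :
  (forall v, exists w, p w = v) -> (forall w, p w = 0 -> exists w', i w' = w) ->
  (forall v, exists t, tens_map2 R p t = v) /\
  (forall t, tens_map2 R p t = 0 -> exists t', tens_map2 R i t' = t).
Proof.
move=> psurj pker; split.
  elim/tens_ind => [|s t [s' <-] [t' <-]|r v].
  - by exists 0; rewrite raddf0.
  - by exists (s' + t'); rewrite raddfD.
  - by have [w <-] := psurj v; exists (pure r w); rewrite tens_map2E.
have [s sE] := choice psurj; pose Q := quotm_pi (imm (tens_map2 R i)).
have Qp r w w' : p w = p w' -> Q (pure r w) = Q (pure r w').
  move=> /eqP; rewrite -subr_eq0 -raddfB => /eqP/pker[u uE].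
  apply/quotm_piE/asboolP; exists (pure r u); rewrite /= tens_map2E uE.
  exact: (raddfB (lin_of (pure_linearr r))).
have bl v : linear (fun r => Q (pure r (s v))).
  by move=> a u u'; rewrite pure_linearl; exact: (linearP (quotm_pi (imm (tens_map2 R i)))).
have br r : linear (fun v => Q (pure r (s v))).
  move=> a u v; rewrite -[RHS](linearP (quotm_pi (imm (tens_map2 R i)))) -pure_linearr.
  by apply: Qp; rewrite linearP !sE.
move=> t pt; suff /quotm_piE : Q t = Q 0 by rewrite subr0 => /asboolP.
rewrite (_ : Q 0 = tens_lin bl br 0); last by rewrite raddf0; exact: (raddf0 (quotm_pi _)).
rewrite -pt; symmetry.
apply: (tens_ext (h := tens_lin bl br \o tens_map2 R p)
  (k := quotm_pi (imm (tens_map2 R i)))) => r w.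
by rewrite /= tens_map2E (tens_liftE bl br); apply: Qp; rewrite sE.
Qed.

End TensorLemmas.
Arguments tens_map2 {A} R {W W'} g.

(** * Finite decompositions; flatness of projective modules *)

Section Resolve.
Variables (A : pzRingType) (X : choiceType) (V : lmodType A).
Variable theta : X -> {linear V -> V}.

(** The identity is required for all finite E containing D so that it passes to sums of elements
    with different D. *)
Definition resolved (t : V) := exists2 D : set X, finite_set D &
  forall E : set X, finite_set E -> (D `<=` E)%classic -> t = \sum_(x \in E) theta x t.

Lemma resolved0 : resolved 0.
Proof.
exists set0 => // E fE _; rewrite fsbig_finite //= big1 // => x _.
by rewrite raddf0.
Qed.

Lemma resolvedD s t : resolved s -> resolved t -> resolved (s + t).
Proof.
move=> [D fD sD] [D' fD' tD']; exists (D `|` D')%classic; first by rewrite finite_setU.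
move=> E fE DE; have sE := sD E fE (fun x Dx => DE x (or_introl Dx)).
have tE := tD' E fE (fun x Dx => DE x (or_intror Dx)).
rewrite [LHS](congr2 +%R sE tE) {sE tE}.
rewrite !fsbig_finite //= -big_split; apply: eq_bigr => x _ /=.
by rewrite raddfD.
Qed.

Lemma resolved_eq0 t : resolved t -> (forall x, theta x t = 0) -> t = 0.
Proof.
move=> [D fD tD] t0; rewrite (tD D) // fsbig_finite //= big1 // => x _; exact: t0.
Qed.

End Resolve.

Notation projective := (projm (fun=> True)).

Section Flat.
Variables (A : comPzRingType) (R : lmodType A) (s : {linear R -> freem A R}).
Hypothesis sK : forall r, aug R (s r) = r.
Variable W : lmodType A.

Fact dual_bl r w : linear (fun u : R => freem_coef (s u) r *: w : W).
Proof. by move=> a u v; rewrite linearP freem_coef_linear scalerDl scalerA. Qed.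

Fact dual_br r u : linear (fun w : W => freem_coef (s u) r *: w).
Proof. by move=> a v w; rewrite scalerDr !scalerA mulrC. Qed.

(* Dual basis: t is the sum of the r (x) dual_coord r t for r in R. *)
Definition dual_coord r : {linear tens R W -> W} :=
  tens_lin (dual_bl r) (dual_br r).

Lemma dual_resolved t :
  resolved (fun r => lin_of (pure_linearr r) \o dual_coord r) t.
Proof.
elim/tens_ind: t => [|t t'|u w]; first exact: resolved0.
  exact: resolvedD.
exists [set r | freem_coef (s u) r != 0]%classic; first exact: freem_coef_finite.
move=> E fE DE; rewrite -{1}(sK u) [aug _ _](freem_liftE _ fE) //.
rewrite !fsbig_finite //= [LHS](raddf_sum (lin_of (pure_linearl w))) /=.
apply: eq_bigr => r _; rewrite (tens_liftE (dual_bl r) (dual_br r)).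
by rewrite pureZr pureZl.
Qed.

End Flat.

Lemma projective_dual (A : comPzRingType) (R : lmodType A) : projective R ->
  exists s : {linear R -> freem A R}, forall r, aug R (s r) = r.
Proof.
by move=> pR; apply: (pR _ _ (aug R) idfun) => // u; exact: aug_surj.
Qed.

(** Dual coordinates are natural in W: those of the image of t are the images under i of those of t.
    If t maps to 0, its coordinates vanish by injectivity of i, hence t = 0. *)
Lemma projective_flat (A : comPzRingType) (R W W' : lmodType A)
    (i : {linear W -> W'}) : projective R -> injective i -> injective (tens_map2 R i).
Proof.
move=> /projective_dual[s sK] iI; apply: raddf_inj => t it0.
apply: (resolved_eq0 (dual_resolved sK t)) => r.
suff dt0 : dual_coord s W r t = 0 by rewrite [LHS](congr1 (pure r) dt0) pure0r.
apply: iI; rewrite raddf0; have ->: i (dual_coord s W r t) = dual_coord s W' r (tens_map2 R i t).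
  apply: (tens_ext (h := i \o dual_coord s W r)
    (k := dual_coord s W' r \o tens_map2 R i)) => u w /=.
  rewrite tens_map2E (tens_liftE (dual_bl s r) (dual_br s r)).
  by rewrite (tens_liftE (dual_bl s r) (dual_br s r)) linearZ.
by rewrite it0 raddf0.
Qed.

(* I R is the image of the flat module R (x) I. *)
Section IdealAction.
Variables (A : comPzRingType) (I : submodClosed A^o) (R : lmodType A).

Fact ideal_act_bl (a : subm I) : linear (fun r : R => subm_val a *: r).
Proof. by move=> b u v; rewrite scalerDr !scalerA mulrC. Qed.

Fact ideal_act_br (r : R) : linear (fun a : subm I => subm_val a *: r).
Proof. by move=> b u v; rewrite linearP scalerDl scalerA. Qed.

Definition ideal_act : {linear tens R (subm I) -> R} :=
  tens_lin ideal_act_bl ideal_act_br.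

Lemma ideal_actE r a : ideal_act (pure r a) = subm_val a *: r.
Proof. exact: tens_linE. Qed.

Lemma ideal_act_inj : projective R -> injective ideal_act.
Proof.
move=> pR; have [s sK] := projective_dual pR; apply: raddf_inj => t it0.
apply: (resolved_eq0 (dual_resolved sK t)) => r.
suff dt0 : dual_coord s (subm I) r t = 0 by rewrite [LHS](congr1 (pure r) dt0) pure0r.
apply: val_inj; rewrite raddf0.
(* Viewed in A, the coordinate of t in I is a coefficient of [s] at the product [ideal_act t], so it
   depends on that product only. *)
have -> : val (dual_coord s (subm I) r t) = freem_coef (s (ideal_act t)) r.
  apply: (tens_ext (h := @subm_val _ _ I \o dual_coord s (subm I) r)
    (k := lin_of (freem_coef_lin r) \o s \o ideal_act)) => u a /=.
  rewrite (tens_liftE (dual_bl s r) (dual_br s r)).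
  rewrite (tens_liftE ideal_act_bl ideal_act_br) linearZ /= /freem_coef.
  by rewrite linearZ /=; exact: mulrC.
by rewrite it0 raddf0.
Qed.

Lemma idealm_act v : v \in idealm I R <-> exists t, ideal_act t = v.
Proof.
split; last first.
  move=> [t <-]; elim/tens_ind: t => [|t t' It It'|r a].
  - by rewrite raddf0 rpred0.
  - by rewrite raddfD rpredD.
  rewrite ideal_actE; apply: genm_sub; exists (subm_val a), r; split=> //.
  exact: valP.
move/asboolW => Iv; apply: (asboolW (Iv (imm ideal_act) _)) => _ [a [m [Ia ->]]].
apply/asboolP; by exists (pure m (exist _ a Ia : subm I)); exact: ideal_actE.
Qed.

End IdealAction.

Section Coords.
Variables (A : comPzRingType) (S : choiceType).
Variables (R R' : lmodType A).

Fact coord_bl (x : S) (f : freem A S) : linear (fun r : R => freem_coef f x *: r).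
Proof. by move=> a u v; rewrite scalerDr !scalerA mulrC. Qed.

Fact coord_br (x : S) (r : R) : linear (fun f : freem A S => freem_coef f x *: r).
Proof. by move=> a f h; rewrite freem_coef_linear scalerDl scalerA. Qed.

(* Coordinates of R (x) A^(S) as a direct sum of copies of R. *)
Definition coord (x : S) : {linear tens R (freem A S) -> R} :=
  tens_lin (coord_bl x) (coord_br x).

Definition incl (x : S) : {linear R -> tens R (freem A S)} :=
  lin_of (pure_linearl (freem_single A x)).

Lemma coord_resolved t : resolved (fun x => incl x \o coord x) t.
Proof.
elim/tens_ind: t => [|t t'|r f]; first exact: resolved0.
  exact: resolvedD.
exists [set x | freem_coef f x != 0]%classic; first exact: freem_coef_finite.
move=> E fE DE; rewrite -{1}(freem_lift_singles f) (freem_liftE _ fE) //.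
rewrite !fsbig_finite //= [LHS](raddf_sum (lin_of (pure_linearr r))) /=.
apply: eq_bigr => x _; rewrite (tens_liftE (coord_bl x) (coord_br x)).
by rewrite pureZr pureZl.
Qed.

Fact copair_bl (g : S -> {linear R -> R'}) f : linear (fun r => freem_lift (g^~ r) f).
Proof.
move=> a u v; rewrite -freem_lift_linear2; congr (freem_lift _ f).
by apply: funext => x; rewrite linearP.
Qed.

Fact copair_br (g : S -> {linear R -> R'}) r : linear (freem_lift (fun x => g x r)).
Proof. exact: linearP. Qed.

(** Together with [incl_ext], this is the universal property of R (x) A^(S) as a direct sum of
    copies of R. *)
Definition copair (g : S -> {linear R -> R'}) : {linear tens R (freem A S) -> R'} :=
  tens_lin (copair_bl g) (copair_br g).

Lemma copairE g r x : copair g (incl x r) = g x r.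
Proof.
by rewrite /= (tens_liftE (copair_bl g) (copair_br g)) freem_lift_single.
Qed.

Lemma incl_ext (h k : {linear tens R (freem A S) -> R'}) :
  (forall x r, h (incl x r) = k (incl x r)) -> forall t, h t = k t.
Proof.
move=> hk; apply: tens_ext => r.
apply: (freem_ext (h := h \o lin_of (pure_linearr r)) (k := k \o lin_of (pure_linearr r))).
by move=> x; exact: hk.
Qed.

End Coords.

Lemma projm_tens_free (A : comPzRingType) (K : lmodType A -> Prop) (R : lmodType A)
  (S : choiceType) : projm K R -> projm K (tens R (freem A S)).
Proof.
move=> pR X Y p f KX KY fp.
have /choice[g gE] : forall x : S, exists g : {linear R -> X},
    forall u, p (g u) = f (incl R x u).
  by move=> x; apply: (pR _ _ p (f \o incl R x)) => // u; exact: fp.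
exists (copair g); apply: (incl_ext (h := p \o copair g)) => x r.
by rewrite -gE; congr (p _); exact: copairE.
Qed.

(** * Vanishing of derived functors on complexes *)

Section QuotientPi.
Variables (A : pzRingType) (V : lmodType A) (W : submodClosed V).

Lemma quotm_pi0 : quotm_pi W 0 = 0. Proof. exact: raddf0. Qed.

Lemma quotm_piN v : quotm_pi W (- v) = - quotm_pi W v.
Proof. exact: raddfN. Qed.

Lemma quotm_piZ a v : quotm_pi W (a *: v) = a *: quotm_pi W v.
Proof. exact: linearZ. Qed.

Lemma quotm_pi_eq0 v : quotm_pi W v = 0 <-> v \in W.
Proof. by rewrite -quotm_pi0 quotm_piE subr0. Qed.

End QuotientPi.

Section QuotientLift.
Variables (A : pzRingType) (V Y : lmodType A) (W : submodClosed V).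
Variables (f : {linear V -> Y}) (f0 : forall v, v \in W -> f v = 0).

Fact quotm_lift_pi v : f (repr (quotm_pi W v)) = f v.
Proof. by apply/eqP; rewrite -subr_eq0 -raddfB; apply/eqP/f0/quotm_reprB. Qed.

Fact quotm_lift_linear : linear (fun q : quotm W => f (repr q)).
Proof.
move=> a; elim/quotm_ind => u; elim/quotm_ind => v.
by rewrite -[X in repr X](linearP (quotm_pi W)) !quotm_lift_pi linearP.
Qed.

Definition quotm_lift : {linear quotm W -> Y} := lin_of quotm_lift_linear.

Lemma quotm_liftE v : quotm_lift (quotm_pi W v) = f v.
Proof. exact: quotm_lift_pi. Qed.

End QuotientLift.

(** * Reduction modulo an ideal *)

Section Reduction.
Variables (A : comPzRingType) (I : submodClosed A^o).

(** These are the A/I-modules, seen as A-modules; the actual change of rings is postponed to the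
    end. *)
Definition killed (X : lmodType A) := forall a (x : X), a \in I -> a *: x = 0.

Lemma killed_idealm (R Y : lmodType A) (f : {linear R -> Y}) :
  killed Y -> forall v, v \in idealm I R -> f v = 0.
Proof.
move=> KY v /asboolW Iv; apply/eqP; apply: (Iv (kerm f)).
by move=> _ [a [m [Ia ->]]]; apply/eqP; rewrite linearZ /= KY.
Qed.

Lemma killed_red (R : lmodType A) : killed (quotm (idealm I R)).
Proof.
move=> a x Ia; elim/quotm_ind: x => v.
by rewrite -quotm_piZ; apply/quotm_pi_eq0/genm_sub; exists a, v.
Qed.

Lemma killed_prod (X Y : lmodType A) : killed X -> killed Y -> killed (X * Y)%type.
Proof. by move=> KX KY a [x y] Ia; congr pair; [exact: KX|exact: KY]. Qed.

Lemma killed_zerom : killed (zerom A).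
Proof. by move=> a x _; exact: zeromE. Qed.

(** A lift R -> X vanishes on IR because IX = 0, hence factors through R/IR. *)
Lemma projm_red (R : lmodType A) : projective R -> projm killed (quotm (idealm I R)).
Proof.
move=> pR X Y p f KX KY fp.
have [g gE] := pR X Y p (f \o quotm_pi (idealm I R)) Logic.I Logic.I (fun u => fp _).
exists (quotm_lift (killed_idealm g KX)); elim/quotm_ind => v.
by rewrite quotm_liftE gE.
Qed.

Definition red_map (R R' : lmodType A) (f : {linear R -> R'}) :
    {linear quotm (idealm I R) -> quotm (idealm I R')} :=
  quotm_lift (killed_idealm (quotm_pi (idealm I R') \o f) (@killed_red R')).

Lemma red_mapE (R R' : lmodType A) (f : {linear R -> R'}) v :
  red_map f (quotm_pi _ v) = quotm_pi _ (f v).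
Proof. exact: quotm_liftE. Qed.

Fact redc_difK (R : cplx A) i x : red_map (dif R i) (red_map (dif R i.+1) x) = 0.
Proof. by elim/quotm_ind: x => v; rewrite !red_mapE difK quotm_pi0. Qed.

Fact redc_obj0 (R : cplx A) (x : quotm (idealm I (R 0%N))) : x = 0.
Proof. by elim/quotm_ind: x => v; rewrite (obj0 v) quotm_pi0. Qed.

Definition redc (R : cplx A) : cplx A := Cplx (@redc_difK R) (@redc_obj0 R).

End Reduction.

Section TensorComplex.
Variables (A : comPzRingType).

Fact tensc_difK (R : cplx A) W i x : tens_map W (dif R i) (tens_map W (dif R i.+1) x) = 0.
Proof. by rewrite tens_map_comp tens_map0 // => m; exact: difK. Qed.

Fact tensc_obj0 (R : cplx A) W (x : tens (R 0%N) W) : x = 0.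
Proof. by elim/tens_ind: x => [|s t -> ->|r w]; rewrite ?addr0 // (obj0 r) pure0l. Qed.

Definition tensc (R : cplx A) W : cplx A := Cplx (@tensc_difK R W) (@tensc_obj0 R W).

Fact tensc_map_chain (R : cplx A) (W W' : lmodType A) (g : {linear W -> W'}) i x :
  dif (tensc R W') i (tens_map2 (R i.+1) g x) = tens_map2 (R i) g (dif (tensc R W) i x).
Proof. exact: tens_map_map2. Qed.

Definition tensc_map (R : cplx A) (W W' : lmodType A) (g : {linear W -> W'}) : chmap (tensc R W) (tensc R W') :=
  @Chmap _ (tensc R W) (tensc R W') (fun i => tens_map2 (R i) g) (tensc_map_chain g).

End TensorComplex.

(* An abstract version of "T(C) is exact at C_{i+1}", where T is Hom(-, V) or
   - (x) V for a fixed module V with I V = 0. *)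
Record exactness_test (A : comPzRingType) (I : submodClosed A^o) := ExactnessTest {
  hx :> cplx A -> nat -> Prop;
  hx_contr : forall (C : cplx A) i (s : {linear C i -> C i.+1}) (s' : {linear C i.+1 -> C i.+2}),
    (forall x, x = dif C i.+1 (s' x) + s (dif C i x)) -> hx C i;
  hx_cone : forall (X Y : cplx A) (f : chmap X Y) i, hx Y i -> hx (shift X) i -> hx (cone f) i;
  hx_cone_inv : forall (X Y : cplx A) (f : chmap X Y) i, hx X i -> hx (cone f) i -> hx Y i;
  hx_shift : forall (X : cplx A) i, hx (shift X) i.+1 <-> hx X i;
  hx_shift0 : forall X : cplx A, hx (shift X) 0%N;
  hx_free : forall (R : cplx A) (S : choiceType) i, hx R i -> hx (tensc R (freem A S)) i;
  hx_red : forall (R : cplx A) i, hx R i -> hx (redc I R) i }.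

Section Null.
Variables (A : comPzRingType) (I : submodClosed A^o) (T : exactness_test I).

(* The derived functors of T vanish on Y up to index n, as computed on a
   projective resolution R of Y. *)
Definition null n (Y : cplx A) := exists (R : cplx A) (r : chmap R Y),
  [/\ forall i, projective (R i), forall i, ex_at (cone r) i & forall i, (i < n)%N -> T R i].

Lemma shift_proj K (R : cplx A) : (forall i, projm K (R i)) -> forall i, projm K (shift R i).
Proof. by move=> pR [|i]; [exact: projm_zero|exact: pR]. Qed.

Lemma test_shift n (R : cplx A) : (forall i, (i < n)%N -> T R i) ->
  forall i, (i < n.+1)%N -> T (shift R) i.
Proof. by move=> TR [|i] ltin; [exact: hx_shift0|apply/hx_shift/TR]. Qed.

Lemma null_proj n (R : cplx A) : (forall i, projective (R i)) ->
  (forall i, (i < n)%N -> T R i) -> null n R.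
Proof.
move=> pR TR; exists R, (@Chmap _ R R (fun=> idfun) (fun _ _ => erefl)); split=> //.
move=> i [y x] /= [dyx dx].
(* The cone of the identity is contracted by (y, x) |-> (0, y). *)
exists (0, y); congr pair; rewrite /= ?raddf0 ?add0r //.
by apply/eqP; rewrite eqr_oppLR -addr_eq0 dyx.
Qed.

Lemma null_exact n (Y : cplx A) : (forall i, ex_at Y i) -> null n Y.
Proof.
move=> exY; pose z : chmap (zeroc A) Y :=
  @Chmap _ _ _ (fun=> \0) (fun i x => raddf0 (dif Y i)).
exists (zeroc A), z; split=> [i|i [y x] /= [dyx _]|i _].
- exact: projm_zero.
- rewrite addr0 in dyx; have [b bE] := exY _ _ dyx.
  exists (b, 0); congr pair => /=; first by rewrite addr0.
  by case: i {dyx b bE y} x => [|i] x; rewrite (zeromE x) ?oppr0.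
apply: (@hx_contr _ _ T _ _ \0 \0) => x; rewrite (zeromE x) /=.
by rewrite addr0.
Qed.

Section ShortExact.
Variables (X' X X'' : cplx A) (i : chmap X' X) (p : chmap X X'').
Hypothesis i_inj : forall n, injective (i n).
Hypothesis p_surj : forall n y, exists x, p n x = y.
Hypothesis pi0 : forall n x, p n (i n x) = 0.
Hypothesis ip : forall n x, p n x = 0 -> exists x', i n x' = x.

(** A resolution of X'' is the cone of a lift b : R' -> R of i. The shift of R' in this cone turns n
    into n + 1. *)
Lemma null_ses n : null n X' -> null n.+1 X -> null n.+1 X''.
Proof.
case=> R' [r' [pR' exR' TR']] [R [r [pR exR TR]]].
have fl j : linear (fun x => (i j (r' j x), 0) : cone r j).
  by move=> a u v; congr pair; rewrite /= ?scaler0 ?addr0 // !linearP.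
have fE j x : dif (cone r) j (lin_of (fl j.+1) x) = lin_of (fl j) (dif R' j x).
  by congr pair; rewrite /= raddf0 ?addr0 // !cmapE.
pose f : chmap R' (cone r) := @Chmap _ R' (cone r) _ fE.
(* Since cone(r) is exact, the composite R' -> X -> cone(r) is null-homotopic. The component [be] of
   the homotopy is a chain map R' -> R, and [al] is a homotopy between i r' and r [be]. *)
have [h hE] := homotopy f pR' (fun=> Logic.I).
have {hE} hE j x := hE j (fun k _ => exR k) x.
pose al j : {linear R' j -> X j.+1} := fst \o h j.
pose be j : {linear R' j -> R j} := snd \o h j.
have alE j x : i j.+1 (r' j.+1 x) =
    dif X j.+1 (al j.+1 x) + r j.+1 (be j.+1 x) + al j (dif R' j x).
  by have /(congr1 fst) := hE j x.
(* On cycles the term [al (d x)] disappears, and the identity then makes sense at index 0 as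
   well. *)
have alE0 j (x : shift R' j.+1) : dif (shift R') j x = 0 ->
    i j (r' j x) = dif X j (al j x) + r j (be j x).
  case: j x => [|j] x; first by move=> _; rewrite [LHS]obj0 [RHS]obj0.
  by move=> /eqP; rewrite oppr_eq0 => /eqP x0; rewrite alE x0 raddf0 addr0.
have beE j x : dif R j (be j.+1 x) = be j (dif R' j x).
  have /(congr1 snd) /esym := hE j x.
  by rewrite /= addrC => /eqP; rewrite subr_eq0 => /eqP.
move: al be alE alE0 beE => al be alE alE0 beE {f h hE fE fl}.
pose b := Chmap beE.
pose zal j : {linear shift R' j -> X j} :=
  match j with 0%N => \0 | k.+1 => al k end.
(* Subtracting [al] makes this a chain map, because p kills i r'. *)
pose z j : {linear cone b j -> X'' j} := p j \o ((r j \o fst) \- (zal j \o snd)).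
have zE j x : dif X'' j (z j.+1 x) = z j (dif (cone b) j x).
  case: j x => [|j] [x x']; first by rewrite [LHS]obj0 [RHS]obj0.
  have := pi0 (r' j.+1 x'); rewrite alE !raddfD /= => /eqP; rewrite addr_eq0 => /eqP key.
  rewrite cmapE !raddfB /= !raddfN cmapE !raddfD /=.
  by rewrite -key opprD [- _ - _]addrC addrA addrK.
exists (cone b), (Chmap zE); split.
- by move=> j; apply: projm_prod; [exact: pR|exact: shift_proj].
- move=> [|j] [y xx'].
    have [u uE] := p_surj y; have [|[v w] vw _] := exR 0%N (u, 0); first exact: obj0.
    exists (p _ v, (w, 0)); congr pair; last by rewrite [LHS](obj0 (c := cone b)) [RHS](obj0 (c := cone b)).
    have /(congr1 fst) /= vwE := vw.
    by rewrite /= !cmapE raddf0 subr0 -raddfD vwE.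
  case: xx' => x x'; have [u uE] := p_surj y.
  move=> /pair_equal_spec[/= dy] /eqP; rewrite oppr_eq0 => /eqP /pair_equal_spec[/= dx dx'].
  (* The defect of the lift u of y is killed by p, so it is i(t); then (t, x') is a cycle of
     cone(r'), bounded by (v', s'). *)
  have [|t tE] := ip (x := dif X j.+1 u + r j.+1 x - zal j.+1 x').
    by rewrite raddfB raddfD /= -cmapE uE -addrA -raddfB.
  have [|[v' s'] /pair_equal_spec[/= vsE sE]] := exR' j (t, x').
    congr pair; last exact: dx'.
    apply: (i_inj (n := j)); rewrite raddf0 raddfD /= -cmapE tE alE0 //.
    rewrite raddfB raddfD /= difK add0r cmapE addrA addrAC.
    by rewrite addrAC subrK -raddfD dx raddf0.
  have {}sE : dif R' j s' = - x' by rewrite -sE opprK.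
  (* Corrected by the images of v' and s', the pair (u, x) becomes a cycle of cone(r), hence a
     boundary. *)
  have [|[v s] /pair_equal_spec[/= vE {}sE2]] :=
      exR j.+1 (u - i _ v' - al _ s', x - be _ s').
    congr pair; last first.
      apply/eqP; rewrite /= oppr_eq0 raddfB /= beE sE raddfN opprK; exact/eqP.
    rewrite /= !raddfB /=.
    have := tE; rewrite -vsE raddfD /= -cmapE alE sE raddfN /= => tE'.
    move: tE'; rewrite addrA => /addIr key.
    by rewrite -[X in X + _]addrA -opprD addrACA -opprD -key addrA subrr.
  exists (p _ v, (s, - s')); congr pair.
    by rewrite /= raddfN opprK cmapE -raddfD addrA vE subrK raddfB /= pi0 subr0.
  transitivity (- (dif R j.+1 s + be j.+1 (- s')), - - dif R' j (- s')) => //.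
  rewrite (raddfN (be j.+1)) (raddfN (dif R' j)) /= sE !opprK opprD opprK.
  by rewrite [X in X + _]sE2 subrK.
- by move=> j ltj; apply: hx_cone; [exact: TR|exact: (test_shift TR')].
Qed.

End ShortExact.
End Null.

(** * Projective resolutions of complexes *)

Section Approximation.
Variables (A : pzRingType) (Y : cplx A).

Section Step.
Variables (n : nat) (W : lmodType A) (r : {linear W -> Y n}) (K : submodClosed W).

Definition lift_pred : pred (W * Y n.+1)%type :=
  fun u => (u.1 \in K) && (r u.1 == dif Y n u.2).

Fact lift_closed : subsemimod_closed lift_pred.
Proof.
split; first split.
- by rewrite /in_mem /= /lift_pred rpred0 !raddf0 eqxx.
- move=> u v /andP[Ku /eqP ru] /andP[Kv /eqP rv]; apply/andP; split.
    by rewrite /= rpredD.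
  by apply/eqP; rewrite /= !raddfD /= ru rv.
- move=> a u /andP[Ku /eqP ru]; apply/andP; split; first by rewrite /= rpredZ.
  by apply/eqP; rewrite /= !linearZ /= ru.
Qed.

Definition lift_sub : submodClosed (W * Y n.+1)%type :=
  HB.pack lift_pred
    (GRing.isSubmodClosed.Build A (W * Y n.+1)%type lift_pred lift_closed).

(* Free on the cycles of the cone that are still to be made boundaries. *)
Definition lift_mod : lmodType A := freem A (subm lift_sub).
Definition lift_aug : {linear lift_mod -> (W * Y n.+1)%type} :=
  subm_val (W := lift_sub) \o aug (subm lift_sub).
Definition lift_dif : {linear lift_mod -> W} := fst \o lift_aug.
Definition lift_map : {linear lift_mod -> Y n.+1} := snd \o lift_aug.

End Step.

(** The recursion carries only the last term, its map to Y and its submodule of cycles; the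
    differential out of the next term is recovered as [lift_dif]. *)
Definition stage n := {W : lmodType A & ({linear W -> Y n} * submodClosed W)%type}.

Fixpoint approx n : stage n :=
  match n with
  | 0%N => existT (fun W : lmodType A => ({linear W -> Y 0%N} * submodClosed W)%type)
      (zerom A) (\0 : {linear zerom A -> Y 0%N}, kerm (\0 : {linear zerom A -> zerom A}))
  | m.+1 => let: existT W (r, K) := approx m in
      existT (fun W : lmodType A => ({linear W -> Y m.+1} * submodClosed W)%type)
        (lift_mod r K) (lift_map r K, kerm (lift_dif r K))
  end.

End Approximation.

(** If (y, w) is a cycle of the cone, then -w is a cycle with r(-w) = d y, so (-w, y) lies in
    [lift_sub] and is hit by some x of the next free term; (0, x) then bounds (y, w). *)
Lemma approximation (A : pzRingType) (Y : cplx A) : exists (R : cplx A) (r : chmap R Y),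
  (forall i, projective (R i)) /\ (forall i, ex_at (cone r) i).
Proof.
pose R n := projT1 (approx Y n).
pose r n : {linear R n -> Y n} := (projT2 (approx Y n)).1.
pose K n : submodClosed (R n) := (projT2 (approx Y n)).2.
have dP n : { d : {linear R n.+1 -> R n} | [/\ 
     forall x, d x \in K n, forall x, r n (d x) = dif Y n (r n.+1 x),
     forall x, (x \in K n.+1) = (d x == 0) &
     forall w y, w \in K n -> r n w = dif Y n y -> exists x, d x = w /\ r n.+1 x = y]}.
  rewrite /R /r /K /=; case: (approx Y n) => W [rr KK] /=.
  exists (lift_dif rr KK); split.
  - by move=> x; have /andP[] := valP (aug (subm (lift_sub rr KK)) x).
  - by move=> x; have /andP[_ /eqP] := valP (aug (subm (lift_sub rr KK)) x).
  - by [].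
  - move=> w y Kw rw; have wyP : (w, y) \in lift_sub rr KK.
      by apply/andP; split=> //; apply/eqP.
    have [x xE] := aug_surj (exist _ (w, y) wyP : subm (lift_sub rr KK)).
    by exists x; split; rewrite /lift_dif /lift_map /lift_aug /= xE.
pose d n := sval (dP n).
have dK n x : d n (d n.+1 x) = 0.
  have [_ _ KE _] := svalP (dP n); have [dKn _ _ _] := svalP (dP n.+1).
  by apply/eqP; rewrite -KE; exact: dKn.
pose RC := @Cplx _ R d dK (@zeromE A).
have rE n x : dif Y n (r n.+1 x) = r n (d n x) by have [_ -> _ _] := svalP (dP n).
exists RC, (@Chmap _ RC Y r rE); split.
  case=> [|n]; first exact: projm_zero.
  rewrite /= /R /=; case: (approx Y n) => W [rr KK]; exact: projm_freem.
move=> n [y w] /pair_equal_spec[/= dy dw].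
have Kw : - w \in K n.
  apply: submN; case: n y w dy dw => [|n] y w dy dw; first by rewrite [w]zeromE rpred0.
  have [_ _ KE _] := svalP (dP n); rewrite KE -oppr_eq0; exact/eqP.
have [_ _ _ ex] := svalP (dP n).
have [|x [xw xy]] := ex (- w) y Kw.
  by apply/eqP; rewrite raddfN eqr_oppLR -addr_eq0 addrC dy.
exists (0, x); congr pair; first by rewrite /= raddf0 add0r.
by rewrite /= [d n x]xw opprK.
Qed.

(** * Descent from A to A/I for complexes *)

Section Iteration.
Variables (A : comPzRingType) (I : submodClosed A^o) (T : exactness_test I).

Lemma null_le m n (Y : cplx A) : (m <= n)%N -> null T n Y -> null T m Y.
Proof.
move=> mn [R [r [pR exR TR]]]; exists R, r; split=> // i im.
exact/TR/(leq_trans im mn).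
Qed.

(** Dimension shifting along 0 -> W' -> A^(W) -> W -> 0, which stays exact after tensoring with the
    flat modules R_i. The middle term is projective and passes the test by [hx_free]; W' is covered
    by induction on n, for all W at once. *)
Lemma null_tensor n (R : cplx A) W : (forall i, projective (R i)) ->
  (forall i, (i < n)%N -> T R i) -> null T n (tensc R W).
Proof.
move=> pR; elim: n W => [|n IHn] W TR.
  by have [P [p [pP exP]]] := approximation (tensc R W); exists P, p; split.
pose W' := subm (kerm (aug W)).
pose i : {linear W' -> freem A W} := subm_val (W := kerm (aug W)).
have ex : forall f, aug W f = 0 -> exists k, i k = f.
  by move=> f /eqP f0; exists (exist _ f f0 : W').
apply: (@null_ses _ _ _ _ _ _ (tensc_map R i) (tensc_map R (aug W))).
- move=> j; apply: projective_flat; [exact: pR|exact: val_inj].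
- by move=> j y; exact: (tens_right_exact (R j) (@aug_surj _ W) ex).1.
- move=> j x; rewrite /= tens_map2_comp.
  apply: (tens_ext (h := tens_map2 _ (aug W \o i)) (k := \0)) => u k.
  by rewrite /= tens_map2E /= (eqP (valP k)) pure0r.
- by move=> j x; exact: (tens_right_exact (R j) (@aug_surj _ W) ex).2.
- by apply: IHn => j jn; exact/TR/ltnW.
- by apply: null_proj => j; [exact: projm_tens_free|move=> jn; exact/hx_free/TR].
Qed.

Section Step.
Variables (Y R : cplx A) (r : chmap R Y).
Hypotheses (KY : forall i, killed I (Y i)) (pY : forall i, projm (killed I) (Y i)).
Hypotheses (pR : forall i, projective (R i)) (exR : forall i, ex_at (cone r) i).

Fact red_adj_chain i x : dif Y i (quotm_lift (killed_idealm (r i.+1) (@KY _)) x) =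
  quotm_lift (killed_idealm (r i) (@KY _)) (dif (redc I R) i x).
Proof.
by elim/quotm_ind: x => x; rewrite quotm_liftE [dif (redc I R) i _]red_mapE quotm_liftE cmapE.
Qed.

Definition red_adj : chmap (redc I R) Y :=
  @Chmap _ (redc I R) Y (fun i => quotm_lift (killed_idealm (r i) (@KY _))) red_adj_chain.

Lemma killed_shift (X : cplx A) : (forall i, killed I (X i)) -> forall i, killed I (shift X i).
Proof. by move=> KX [|i]; [exact: killed_zerom|exact: KX]. Qed.

Lemma killed_cone i : killed I (cone red_adj i).
Proof. apply: killed_prod => //; apply: killed_shift => j; exact: killed_red. Qed.

Lemma projm_cone i : projm (killed I) (cone red_adj i).
Proof. by apply: projm_prod => //; apply: shift_proj => j; exact: projm_red. Qed.

(** [null_ses] is applied to 0 -> R[1] (x) I -> cone(r) -> [cone red_adj] -> 0. The first map lands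
    in the shifted summand and commutes with the differentials because r vanishes on IR, as IY =
    0. *)
Lemma null_cone n : (forall i, (i < n)%N -> T R i) -> null T n (cone red_adj).
Proof.
move=> TR; apply: (null_le (leqnSn n)).
pose X' := tensc (shift R) (subm I).
have il j : linear (fun t : X' j => (0, ideal_act I _ t) : cone r j).
  by move=> a u v; congr pair; [rewrite /= scaler0 addr0|exact: linearP].
have actE j t : dif (shift R) j (ideal_act I _ t) = ideal_act I _ (dif X' j t).
  apply: (tens_ext (h := dif (shift R) j \o ideal_act I _)
    (k := ideal_act I _ \o dif X' j)) => u a.
  rewrite [LHS](congr1 (dif (shift R) j) (ideal_actE _ _)) linearZ.
  by rewrite [RHS](congr1 (ideal_act I _) (tens_mapE _ _ _)) [RHS]ideal_actE.
have iE j t : dif (cone r) j (lin_of (il j.+1) t) = lin_of (il j) (dif X' j t).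
  congr pair; last exact: actE.
  rewrite [LHS](_ : _ = dif Y j 0 + r j (ideal_act I _ t)) // raddf0 add0r.
  by apply: (killed_idealm (r j) (@KY _)); apply/idealm_act; exists t.
pose pi j : {linear shift R j -> shift (redc I R) j} :=
  shift_map (X := R) (Y := redc I R) (fun k => quotm_pi (idealm I (R k))) j.
have pl j : linear (fun c : cone r j => (c.1, pi j c.2) : cone red_adj j).
  by move=> a u v; congr pair; exact: linearP.
have pE j c : dif (cone red_adj) j (lin_of (pl j.+1) c) = lin_of (pl j) (dif (cone r) j c).
  case: c => y x; congr pair.
    by congr (_ + _); exact: quotm_liftE.
  case: j y x => [//|j] y x.
  transitivity (- red_map I (dif R j) (quotm_pi _ x)) => //.
  transitivity (quotm_pi (idealm I (R j)) (- dif R j x)) => //.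
  by rewrite (red_mapE I (dif R j)) quotm_piN.
have TsR : forall i, (i < n)%N -> T (shift R) i.
  by move=> i /ltnW; exact: test_shift.
apply: (@null_ses _ _ T _ _ _ (@Chmap _ X' (cone r) _ iE)
  (@Chmap _ (cone r) (cone red_adj) _ pE)).
- move=> j t t' /pair_equal_spec[_]; apply: ideal_act_inj; exact: shift_proj.
- move=> j [y q]; suff [x xE] : exists x, pi j x = q by exists (y, x); congr pair.
  case: j q {y} => [|j] q; first by exists 0; rewrite [q]zeromE; exact: zeromE.
  by elim/quotm_ind: q => x; exists x.
- move=> j t; congr pair; case: j t => [//|j] t.
  by apply/quotm_pi_eq0/idealm_act; exists t.
- move=> j [y x] /pair_equal_spec[/= -> ]; case: j y x => [|j] _ x.
    by exists 0; congr pair; rewrite [LHS]zeromE [RHS]zeromE.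
  by move=> /quotm_pi_eq0/idealm_act[t <-]; exists t.
- by apply: null_tensor => //; exact: shift_proj.
- exact: null_exact.
Qed.

(** Exactness of Y in degrees < k gives that of R, and projectivity makes R contractible there. A
    contraction survives reduction modulo I, so in a cycle (y, q) of the cone q is the boundary of
    the class of some w. *)
Lemma ex_cone k : (forall i, (i < k)%N -> ex_at Y i) ->
  forall i, (i < k.+1)%N -> ex_at (cone red_adj) i.
Proof.
move=> exY.
have exRk j : (j < k)%N -> ex_at R j.
  move=> jk z dz; have [|y yE] := exY j jk (- r j.+1 z).
    by rewrite raddfN /= cmapE dz raddf0 oppr0.
  have [|[v w] /pair_equal_spec[_ /= wE]] := @exR j.+1 (y, z).
    by congr pair; rewrite /= ?yE ?addNr // dz oppr0.
  by exists (- w); rewrite raddfN.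
have [h hE] := homotopy (@Chmap _ R R (fun=> idfun) (fun _ _ => erefl)) pR (fun=> Logic.I).
move=> i ik [y q] /pair_equal_spec[]; elim/quotm_ind: q => x dy dx.
have {}dx : dif (shift (redc I R)) i (quotm_pi (idealm I (R i)) x) = 0 by exact: dx.
have [w wE] : exists w, quotm_pi (idealm I (R i)) (dif R i w) = quotm_pi _ x.
  case: i ik x {y dy} dx => [|j] jk x dx; first by exists 0; rewrite raddf0 (obj0 x).
  exists (h j.+1 x); 
  have xE : x = dif R j.+1 (h j.+1 x) + h j (dif R j x).
    by apply: hE => l lj; exact/exRk/(leq_ltn_trans lj).
  rewrite [in RHS]xE quotm_piD.
  have dx0 : quotm_pi (idealm I (R j)) (dif R j x) = 0.
    rewrite -(red_mapE I (dif R j)); apply/eqP; rewrite -oppr_eq0; apply/eqP.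
    exact: dx.
  by rewrite -(red_mapE I (h j)) dx0 raddf0 addr0.
have rE j z : red_adj j (quotm_pi (idealm I (R j)) z) = r j z by exact: quotm_liftE.
have {}dy : dif Y i y + r i (dif R i w) = 0 by rewrite -rE wE; exact: dy.
(* Now (y + r(w), 0) is a cycle of cone(r), bounded by some (v, u); modulo I, (v, u - w) bounds the
   original cycle. *)
have [|[v u] /pair_equal_spec[/= uE du]] := @exR i (y + r i.+1 w, 0).
  congr pair; last exact: raddf0.
  by rewrite [r i _]raddf0 addr0 /= raddfD /= cmapE.
exists (v, quotm_pi (idealm I (R i.+1)) (u - w)); congr pair.
  by rewrite /fst /snd rE raddfB addrA uE addrK.
transitivity (- red_map I (dif R i) (quotm_pi _ (u - w))) => //.
rewrite (red_mapE I (dif R i)) -quotm_piN -raddfN opprB raddfB /=.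
have -> : dif R i u = 0 by apply/eqP; rewrite -oppr_eq0; apply/eqP.
by rewrite subr0.
Qed.

End Step.

(** Induction on a bound m for n - k. If k >= n, [homotopy] for the class [killed I], applied to the
    identity of Y, contracts Y in degrees < n. Otherwise [cone red_adj] takes the place of Y, with k
    + 1 for k. *)
Lemma null_test n k (Y : cplx A) : (forall i, killed I (Y i)) ->
  (forall i, projm (killed I) (Y i)) -> null T n Y ->
  (forall i, (i < k)%N -> ex_at Y i) -> forall i, (i < n)%N -> T Y i.
Proof.
elim: {k}(n - k)%N {-2}k Y (leqnn (n - k)) => [|m IHm] k Y nk KY pY nY exY i lin.
  have [h hE] := homotopy (@Chmap _ Y Y (fun=> idfun) (fun _ _ => erefl)) pY KY.
  apply: (@hx_contr _ _ T Y i (h i) (h i.+1)) => x; apply: hE => j ji.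
  apply: exY; apply: (leq_ltn_trans ji); apply: (leq_trans lin).
  by rewrite -subn_eq0 -leqn0.
have [R [r [pR exR TR]]] := nY.
apply: (hx_cone_inv (f := red_adj r KY)); first exact/hx_red/TR.
apply: (IHm k.+1) lin; first by rewrite subnS; case: (n - k)%N nk.
- exact: killed_cone.
- exact: projm_cone.
- exact: null_cone.
- exact: ex_cone.
Qed.

End Iteration.

(** * The functors Hom(-, V) and - (x) V *)

Section HomTest.
Variables (A : comPzRingType) (I : submodClosed A^o) (V : lmodType A).
Hypothesis KV : killed I V.

Definition hom_ex (C : cplx A) i := forall f : {linear C i.+1 -> V},
  (forall x, f (dif C i.+1 x) = 0) -> exists g : {linear C i -> V}, forall x, f x = g (dif C i x).

Fact hom_ex_contr (C : cplx A) i (s : {linear C i -> C i.+1}) (s' : {linear C i.+1 -> C i.+2}) :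
  (forall x, x = dif C i.+1 (s' x) + s (dif C i x)) -> hom_ex C i.
Proof.
move=> sE f fd; exists (f \o s) => x.
by rewrite [in LHS](sE x) raddfD /= fd add0r.
Qed.

Fact hom_ex_cone (X Y : cplx A) (f : chmap X Y) i :
  hom_ex Y i -> hom_ex (shift X) i -> hom_ex (cone f) i.
Proof.
move=> exY exX h hd.
have [|g gE] := exY (h \o inlm _ _); first by move=> y; rewrite -[RHS](hd (inlm _ _ y)) cone_inlE.
(* What is left of h on the summand [shift X] after subtracting g composed with the differential of
   the cone. *)
pose h2 : {linear shift X i.+1 -> V} := (h \o inrm _ _) \- (g \o f i).
have [x|k kE] := exX h2.
  have := hd (inrm _ _ x).
  rewrite (_ : dif (cone f) i.+1 _ = inlm _ _ (f i.+1 x) + inrm _ _ (dif (shift X) i.+1 x)); last first.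
    by rewrite [LHS]pairE; congr (inlm _ _ _ + _); rewrite /= raddf0 add0r.
  rewrite raddfD [X in X + _]gE cmapE /= => hx0.
  by rewrite (raddfN (f i)) (raddfN g) opprK addrC.
exists ((g \o fst) \+ (k \o snd)) => c.
rewrite [in LHS](pairE c) raddfD [X in X + _]gE /=.
by rewrite -[k _](kE c.2) /= raddfD addrACA subrr addr0.
Qed.

Fact hom_ex_cone_inv (X Y : cplx A) (f : chmap X Y) i :
  hom_ex X i -> hom_ex (cone f) i -> hom_ex Y i.
Proof.
move=> exX exc h hd.
have [|g gE] := exX (h \o f i.+1); first by move=> x; rewrite /= -cmapE hd.
(* The sign in [shift] makes (h, g) a cocycle on the cone, since h f = g d. *)
have [[y x]|k kE] := exc ((h \o fst) \+ (g \o snd)).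
  rewrite /= raddfD /= hd add0r [h _]gE -raddfD /=.
  by rewrite subrr raddf0.
exists (k \o inlm _ _) => y; have := kE (inlm _ _ y).
by rewrite cone_inlE /= raddf0 addr0.
Qed.

Fact hom_ex_shift (X : cplx A) i : hom_ex (shift X) i.+1 <-> hom_ex X i.
Proof.
split=> ex h hd.
  have [|g gE] := ex h; first by move=> x; rewrite /= raddfN /= hd oppr0.
  by exists (\- g) => x; rewrite gE /= raddfN.
have [|g gE] := ex h; first by move=> x; apply/eqP; rewrite -oppr_eq0 -raddfN; apply/eqP/hd.
by exists (\- g) => x; rewrite gE /= raddfN opprK.
Qed.

Fact hom_ex_shift0 (X : cplx A) : hom_ex (shift X) 0%N.
Proof. by move=> h _; exists \0 => x; rewrite (obj0 x) !raddf0. Qed.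

(** Hom turns a direct sum into a product, so primitives are chosen one coordinate at a time and
    assembled by [copair]. *)
Fact hom_ex_free (R : cplx A) (S : choiceType) i :
  hom_ex R i -> hom_ex (tensc R (freem A S)) i.
Proof.
move=> ex h hd.
have diE j x u : dif (tensc R (freem A S)) j (incl _ x u) = incl _ x (dif R j u).
  exact: tens_mapE.
have /choice[g gE] : forall x : S, exists g : {linear R i -> V},
    forall u, h (incl _ x u) = g (dif R i u).
  move=> x; have [|g gE] := ex (h \o incl _ x); last by exists g.
  by move=> u; rewrite /= -(hd (incl _ x u)) diE.
exists (copair g) => t.
apply: (incl_ext (k := copair g \o dif (tensc R (freem A S)) i)) => x u.
rewrite gE [RHS](congr1 (copair g) (diE _ _ _)); exact/esym/copairE.
Qed.

(** Since IV = 0, maps from R to V are the same as maps from R/IR to V. *)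
Fact hom_ex_red (R : cplx A) i : hom_ex R i -> hom_ex (redc I R) i.
Proof.
move=> ex h hd.
have [|g gE] := ex (h \o quotm_pi (idealm I (R i.+1))).
  by move=> x; rewrite /= -(red_mapE I (dif R i.+1)); exact: hd.
exists (quotm_lift (killed_idealm g KV)); elim/quotm_ind => x.
rewrite [RHS](congr1 (quotm_lift _) (red_mapE _ _ _)) quotm_liftE; exact: gE.
Qed.

Definition hom_test : exactness_test I := ExactnessTest hom_ex_contr hom_ex_cone
  hom_ex_cone_inv hom_ex_shift hom_ex_shift0 hom_ex_free hom_ex_red.

End HomTest.

Section TensorTest.
Variables (A : comPzRingType) (I : submodClosed A^o) (V : lmodType A).
Hypothesis KV : killed I V.

Definition tens_ex (C : cplx A) i := ex_at (tensc C V) i.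

Fact tens_ex_contr (C : cplx A) i (s : {linear C i -> C i.+1}) (s' : {linear C i.+1 -> C i.+2}) :
  (forall x, x = dif C i.+1 (s' x) + s (dif C i x)) -> tens_ex C i.
Proof.
move=> sE t dt; exists (tens_map V s' t).
rewrite /= tens_map_comp -[RHS]tens_map_id.
rewrite -[LHS]addr0 -(raddf0 (tens_map V s)) -dt /= tens_map_comp -tens_mapD.
by apply: eq_tens_map => x; rewrite [RHS]sE.
Qed.

Lemma tens_pairE (X Y : lmodType A) (t : tens (X * Y)%type V) :
  t = tens_map V (inlm X Y) (tens_map V fst t) + tens_map V (inrm X Y) (tens_map V snd t).
Proof.
rewrite !tens_map_comp -tens_mapD -[LHS]tens_map_id.
by apply: eq_tens_map => c; exact: pairE.
Qed.

Lemma tens_map_sq (M M1 M2 M3 : lmodType A) (f : {linear M -> M1})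
    (g : {linear M1 -> M3}) (f' : {linear M -> M2}) (g' : {linear M2 -> M3}) :
  (forall m, g (f m) = g' (f' m)) ->
  forall t, tens_map V g (tens_map V f t) = tens_map V g' (tens_map V f' t).
Proof. by move=> sq t; rewrite !tens_map_comp; apply: eq_tens_map. Qed.

Lemma tens_mapN (M M1 : lmodType A) (f : {linear M -> M1}) t :
  tens_map V (\- f) t = - tens_map V f t.
Proof.
have E : tens_map V (\- f) t + tens_map V f t = 0.
  by rewrite -tens_mapD; apply: tens_map0 => m; exact: addNr.
by apply/eqP; rewrite -addr_eq0 E.
Qed.

Fact tens_ex_cone (X Y : cplx A) (f : chmap X Y) i :
  tens_ex Y i -> tens_ex (shift X) i -> tens_ex (cone f) i.
Proof.
move=> exY exX t dt.
pose C := tensc (cone f) V.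
pose fs j : {linear cone f j -> Y j} := fst.
pose sn j : {linear cone f j -> shift X j} := snd.
pose il j := tens_map V (inlm (Y j) (shift X j)).
pose ir j := tens_map V (inrm (Y j) (shift X j)).
have dsn j u : tens_map V (dif (shift X) j) (tens_map V (sn j.+1) u) =
    tens_map V (sn j) (dif C j u) by exact: tens_map_sq.
have dil j u : dif C j (il j.+1 u) = il j (tens_map V (dif Y j) u).
  by apply: tens_map_sq => y; exact: cone_inlE.
have snir j u : tens_map V (sn j) (ir j u) = u.
  by rewrite /ir tens_map_comp -[RHS]tens_map_id; exact: eq_tens_map.
have fsil j u : tens_map V (fs j) (il j u) = u.
  by rewrite /il tens_map_comp -[RHS]tens_map_id; exact: eq_tens_map.
have [|u uE] := exX (tens_map V (sn _) t); first by rewrite [LHS]dsn [X in tens_map _ _ X]dt raddf0.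
(* Subtracting this boundary removes the component of t in [shift X], which leaves a cycle coming
   from Y. *)
pose t' : C i.+1 := t - dif C i.+1 (ir _ u).
have t'E : t' = il _ (tens_map V (fs _) t').
  rewrite [LHS]tens_pairE [X in _ + tens_map _ _ X](_ : _ = 0) ?raddf0 ?addr0 //.
  by rewrite raddfB /= -[X in _ - X]dsn snir -[X in X - _]uE subrr.
have dt' : dif C i t' = 0 by rewrite raddfB /= [X in X - _]dt (difK (c := C)) subr0.
have [|w wE] := exY (tens_map V (fs _) t').
  by rewrite -[LHS]fsil -dil -t'E dt' raddf0.
exists (il _ w + ir _ u); rewrite raddfD [X in X + _]dil [X in il _ X]wE -t'E.
by rewrite subrK.
Qed.

Fact tens_ex_cone_inv (X Y : cplx A) (f : chmap X Y) i :
  tens_ex X i -> tens_ex (cone f) i -> tens_ex Y i.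
Proof.
move=> exX exc t dt.
have [|u uE] := exc (tens_map V (inlm _ _) t).
  rewrite [LHS](@tens_map_sq _ _ _ _ _ _ (dif Y i) (inlm _ _)); last first.
    by move=> y; exact: cone_inlE.
  by rewrite [X in tens_map _ _ X]dt raddf0.
pose fs j : {linear cone f j -> Y j} := fst.
pose sn j : {linear cone f j -> shift X j} := snd.
have [|s sE] := exX (tens_map V (sn _) u).
  have E : tens_map V (sn i.+1) (tens_map V (dif (cone f) i.+1) u) =
      - tens_map V (dif X i) (tens_map V (sn i.+2) u).
    by rewrite -tens_mapN; apply: tens_map_sq.
  apply/eqP; rewrite -oppr_eq0 -E [X in tens_map _ _ X]uE tens_map_comp.
  by rewrite tens_map0.
(* The boundary of u in the cone has Y-component d([fst u]) + f([snd u]) = t, and [snd u] = d s, so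
   f(s) accounts for the second term. *)
exists (tens_map V (fs _) u + tens_map V (f _) s).
rewrite raddfD [X in _ + X](@tens_map_sq _ _ _ _ _ _ (dif X i.+1) (f i.+1)); last first.
  by move=> x; exact: cmapE.
rewrite [X in _ + tens_map _ _ X]sE.
have := congr1 (tens_map V (fs _)) uE.
rewrite [X in _ = X -> _]tens_map_comp [X in _ = X -> _](_ : _ = t); last first.
  by rewrite -[RHS]tens_map_id; exact: eq_tens_map.
move=> <-; rewrite /= !tens_map_comp -tens_mapD; exact: eq_tens_map.
Qed.

Fact tens_ex_shift (X : cplx A) i : tens_ex (shift X) i.+1 <-> tens_ex X i.
Proof.
split=> ex t dt.
  have [|u uE] := ex t; first by rewrite [LHS]tens_mapN [X in - X]dt oppr0.
  by exists (- u); rewrite raddfN -[RHS]uE; exact/esym/tens_mapN.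
have [|u uE] := ex t.
  by apply/eqP; rewrite -oppr_eq0; apply/eqP; rewrite -[RHS]dt; exact/esym/tens_mapN.
by exists (- u); rewrite [LHS]tens_mapN raddfN opprK.
Qed.

Fact tens_ex_shift0 (X : cplx A) : tens_ex (shift X) 0%N.
Proof. by move=> t _; exists 0; rewrite raddf0; exact/esym/(@tensc_obj0 _ X V). Qed.

Fact tens_ex_free (R : cplx A) (S : choiceType) i :
  tens_ex R i -> tens_ex (tensc R (freem A S)) i.
Proof.
move=> ex t dt.
pose co j x := tens_map V (@coord _ S (R j) x); pose in_ j (x : S) := tens_map V (incl (R j) x).
have /choice[u uE] : forall x : S, exists u, tens_map V (dif R i.+1) u = co i.+1 x t.
  move=> x; apply: ex.
  rewrite [LHS](@tens_map_sq _ _ _ _ _ _ (dif (tensc R (freem A S)) i) (coord (R i) x)).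
    by rewrite [X in tens_map _ _ X]dt raddf0.
  apply: (tens_ext (h := dif R i \o coord _ x)
    (k := coord _ x \o dif (tensc R (freem A S)) i)) => r g.
  rewrite [LHS](congr1 (dif R i) (tens_linE _ _ _ _)) linearZ.
  by rewrite [RHS](congr1 (coord _ x) (tens_mapE _ _ _)) [RHS]tens_linE.
(* Only finitely many coordinates of t matter, so the chosen primitives can be summed. *)
have [D fD tD] : resolved (fun x => tens_map V (incl (R i.+1) x \o coord _ x)) t.
  elim/tens_ind: t {dt u uE} => [|s t|m v]; first exact: resolved0.
    exact: resolvedD.
  have [D fD mD] := coord_resolved m; exists D => // E fE DE.
  rewrite {1}(mD E fE DE) !fsbig_finite //= [LHS](raddf_sum (lin_of (pure_linearl v))) /=.
  by apply: eq_bigr => x _; rewrite tens_mapE.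
exists (\sum_(x \in D) in_ _ x (u x)).
rewrite [RHS](tD D fD) // !fsbig_finite //= raddf_sum; apply: eq_bigr => x _.
rewrite -[RHS]tens_map_comp -[X in tens_map _ _ X]uE.
by apply: tens_map_sq => r; exact: tens_mapE.
Qed.

(** As IV = 0, the module R (x) V is killed by I, so r |-> r (x) v factors through R/IR; this gives
    a retraction. *)
Lemma tens_pi_inj (R : lmodType A) : injective (tens_map V (quotm_pi (idealm I R))).
Proof.
have KRV : killed I (tens R V).
  move=> a t Ia; elim/tens_ind: t => [|t t' It It'|r v]; first exact: scaler0.
    by rewrite scalerDr It It' addr0.
  transitivity (pure r (a *: v)); last by rewrite KV // pure0r.
  exact/esym/pureZr.
pose b (q : quotm (idealm I R)) v :=
  quotm_lift (killed_idealm (lin_of (pure_linearl v)) KRV) q.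
have bl v : linear (b^~ v) by exact: linearP.
have br q : linear (b q).
  elim/quotm_ind: q => r a v w; rewrite /b !quotm_liftE; exact: pure_linearr.
apply: (can_inj (g := tens_lin bl br)) => t.
apply: (tens_ext (h := tens_lin bl br \o tens_map V (quotm_pi (idealm I R))) (k := idfun)) => r v.
rewrite [LHS](congr1 (tens_lin bl br) (tens_mapE _ _ _)) [LHS]tens_linE.
exact: quotm_liftE.
Qed.

Fact tens_ex_red (R : cplx A) i : tens_ex R i -> tens_ex (redc I R) i.
Proof.
move=> ex t dt; pose pi j := tens_map V (quotm_pi (idealm I (R j))).
have dpi j u : dif (tensc (redc I R) V) j (pi j.+1 u) = pi j (dif (tensc R V) j u).
  by apply: tens_map_sq => r; exact: red_mapE.
have [s sE] : exists s, pi i.+1 s = t.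
  elim/tens_ind: t {dt} => [|t t' [s <-] [s' <-]|q v].
  - by exists 0; exact: raddf0.
  - by exists (s + s'); exact: raddfD.
  by elim/quotm_ind: q => r; exists (pure r v); exact: tens_mapE.
have [|u uE] := ex s.
  by apply: (@tens_pi_inj (R i)); rewrite raddf0 -[RHS]dt -sE dpi.
by exists (pi _ u); rewrite dpi [X in pi _ X]uE.
Qed.

Definition tensor_test : exactness_test I := ExactnessTest tens_ex_contr tens_ex_cone
  tens_ex_cone_inv tens_ex_shift tens_ex_shift0 tens_ex_free tens_ex_red.

End TensorTest.

(** * Change of rings *)

Section CoefficientSequence.
Variables (A : comPzRingType) (S : cplx A) (N' N N'' : lmodType A).
Variables (i : {linear N' -> N}) (p : {linear N -> N''}).
Hypothesis pS : forall j, projective (S j).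
Hypothesis i_inj : injective i.
Hypothesis p_surj : forall y, exists x, p x = y.
Hypothesis pi0 : forall x, p (i x) = 0.
Hypothesis ip : forall x, p x = 0 -> exists x', i x' = x.

(** The long exact sequence by hand: lift f to h with values in N; the obstruction h d takes values
    in N' and is a cocycle, hence g d for some g; then h - i g is a cocycle with values in N. *)
Lemma hom_ex_coef : (forall j, hom_ex N' S j) -> (forall j, hom_ex N S j) ->
  forall j, hom_ex N'' S j.
Proof.
move=> exN' exN j f fd.
have [h hE] := pS (X := N) (Y := N'') (p := p) (f := f) Logic.I Logic.I (fun u => p_surj _).
have [e eE] := pS (X := N') (Y := N) (p := i) (f := h \o dif S j.+1) Logic.I Logic.I
  (fun u => ip (etrans (hE _) (fd u))).
have [|g gE] := exN' _ e.
  by move=> u; apply: i_inj; rewrite raddf0 eE /= difK raddf0.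
have [|g' gE'] := exN _ (h \- (i \o g)).
  by move=> u; rewrite /= -gE eE subrr.
exists (p \o g') => u; rewrite /= -gE' /= raddfB /= pi0 subr0; exact/esym/hE.
Qed.

Lemma tens_ex_coef : (forall j, tens_ex N' S j) -> (forall j, tens_ex N S j) ->
  forall j, tens_ex N'' S j.
Proof.
move=> exN' exN j t dt.
have [surj kerE] := tens_right_exact (S j.+1) p_surj ip.
have [s sE] := surj t.
have [|u uE] := (tens_right_exact (S j) p_surj ip).2 (dif (tensc S N) j s).
  by rewrite -[LHS]tensc_map_chain [X in dif _ _ X]sE.
(* The connecting element u is a cycle because S_j is flat; at j = 0 it lies in a zero module. *)
have [w wE] : exists w, dif (tensc S N') j w = u.
  case: j t dt s sE u uE {surj kerE} => [|j] t dt s sE u uE.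
    by exists 0; rewrite raddf0 [RHS](obj0 (c := tensc S N')).
  apply: exN'; apply: (projective_flat (@pS j) i_inj); rewrite raddf0.
  by rewrite -[LHS]tensc_map_chain [X in dif _ _ X]uE (difK (c := tensc S N)).
have [|b bE] := exN _ (s - tens_map2 _ i w).
  by rewrite raddfB /= [X in _ - X]tensc_map_chain [X in tens_map2 _ _ X]wE uE subrr.
exists (tens_map2 _ p b); rewrite tensc_map_chain [X in tens_map2 _ _ X]bE raddfB.
rewrite [X in X - _]sE [X in _ - X]tens_map2_comp.
rewrite [X in _ - X](_ : _ = 0) ?subr0 //.
by apply: (tens_ext (h := tens_map2 _ (p \o i)) (k := \0)) => r n; rewrite /= tens_map2E /= pi0 pure0r.
Qed.

End CoefficientSequence.

Section ChangeOfRings.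
Variables (A : comPzRingType) (I : submodClosed A^o).
Notation B := (quotr I).

Section Restriction.
Variable X : lmodType B.

(** A separate name keeps the A-action apart from the B-action on the same group. *)
Definition rest : Type := X.
HB.instance Definition _ := GRing.Zmodule.on rest.

Definition rest_scale (a : A) (x : rest) : rest := quotr_pi I a *: (x : X).

Fact rest_scaleA a b x : rest_scale a (rest_scale b x) = rest_scale (a * b) x.
Proof. by rewrite /rest_scale scalerA -quotr_piM. Qed.
Fact rest_scale1 : left_id 1 rest_scale.
Proof. by move=> x; exact: (scale1r (x : X)). Qed.
Fact rest_scaleDr : right_distributive rest_scale +%R.
Proof. by move=> a x y; exact: (scalerDr (quotr_pi I a) (x : X) y). Qed.
Fact rest_scaleDl x : {morph rest_scale^~ x : a b / a + b}.
Proof. by move=> a b; rewrite /rest_scale quotr_piD; exact: scalerDl. Qed.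
HB.instance Definition _ := GRing.Zmodule_isLmodule.Build A rest
  rest_scaleA rest_scale1 rest_scaleDr rest_scaleDl.

Lemma rest_scaleE a (x : X) : a *: (x : rest) = quotr_pi I a *: x.
Proof. by []. Qed.

Lemma quotr_pi_eq0 a : a \in I -> quotr_pi I a = 0.
Proof. by move=> Ia; apply: (iffRL (quotm_pi_eq0 I _)). Qed.

Lemma killed_rest : killed I rest.
Proof. by move=> a x Ia; rewrite rest_scaleE quotr_pi_eq0 // scale0r. Qed.

End Restriction.

Section Descent.
Variables (Y : lmodType A) (KY : killed I Y).

(* The proof KY is kept in the type so that inference can find the B-action. *)
Definition low : Type := let _ := KY in Y.
HB.instance Definition _ := GRing.Zmodule.on low.

Definition low_scale (b : B) (y : low) : low := repr b *: (y : Y).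

Fact low_scaleE a (y : low) : low_scale (quotr_pi I a) y = a *: (y : Y).
Proof.
apply/eqP; rewrite -subr_eq0 -[X in X == _]scalerBl; apply/eqP/KY.
exact: (quotm_reprB I a).
Qed.

Fact low_scaleA a b y : low_scale a (low_scale b y) = low_scale (a * b) y.
Proof.
elim/quotr_ind: a => a; elim/quotr_ind: b => b.
by rewrite -quotr_piM !low_scaleE scalerA.
Qed.
Fact low_scale1 : left_id 1 low_scale.
Proof. by move=> y; rewrite [low_scale _ _]low_scaleE scale1r. Qed.
Fact low_scaleDr : right_distributive low_scale +%R.
Proof. by move=> a x y; exact: (scalerDr (repr a) (x : Y) y). Qed.
Fact low_scaleDl y : {morph low_scale^~ y : a b / a + b}.
Proof.
elim/quotr_ind=> a; elim/quotr_ind=> b.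
by rewrite -quotr_piD !low_scaleE scalerDl.
Qed.
HB.instance Definition _ := GRing.Zmodule_isLmodule.Build B low
  low_scaleA low_scale1 low_scaleDr low_scaleDl.

End Descent.

Fact rest_map_linear (X X' : lmodType B) (f : {linear X -> X'}) :
  linear (f : rest X -> rest X').
Proof. by move=> a u v; exact: linearP. Qed.

Definition rest_map (X X' : lmodType B) (f : {linear X -> X'}) :
  {linear rest X -> rest X'} := lin_of (rest_map_linear f).

Lemma unrest_linear (X X' : lmodType B) (f : {linear rest X -> rest X'}) :
  linear (f : X -> X').
Proof. by elim/quotr_ind=> a u v; exact: (linearP f a). Qed.

Lemma low_linear (X : lmodType B) (Y : lmodType A) (KY : killed I Y)
  (f : {linear X -> low KY}) : linear (f : rest X -> Y).
Proof.
move=> a u v; transitivity (f (quotr_pi I a *: (u : X) + (v : X))) => //.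
rewrite linearP. exact: (congr1 (fun z : Y => z + (f v : Y)) (low_scaleE a (f u))).
Qed.

Lemma linear_low (X : lmodType B) (Y : lmodType A) (KY : killed I Y)
  (f : {linear rest X -> Y}) : linear (f : X -> low KY).
Proof.
elim/quotr_ind=> a u v; transitivity (a *: f u + f v); first exact: (linearP f a).
exact: (congr1 (fun z : Y => z + f v) (esym (low_scaleE (KY := KY) a (f u)))).
Qed.

(** A module killed by I is a B-module through [low], so lifts may be prescribed on the basis. *)
Lemma projm_rest_free (X : choiceType) : projm (killed I) (rest (freem B X)).
Proof.
move=> E Y p f KE KY fp.
have /choice[g gE] : forall x : X, exists e, p e = f (freem_single B x).
  by move=> x; exact: fp.
have gl := low_linear (freem_lift (g : X -> low KE)).
exists (lin_of gl) => u.
have := freem_ext (h := lin_of (linear_low KY (p \o lin_of gl))) (k := lin_of (linear_low KY f)).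
apply=> x; rewrite [RHS](esym (gE x)); congr (p _).
exact: (freem_lift_single (g : X -> low KE)).
Qed.

Section Tensor.
Variables (P V : lmodType B).

Fact to_tens_bl (v : V) : linear (fun u : rest P => pure (u : P) v : rest (tens P V)).
Proof. by move=> a u w; exact: pure_linearl. Qed.
Fact to_tens_br (u : P) : linear (fun v : rest V => pure u (v : V) : rest (tens P V)).
Proof. by move=> a v w; exact: pure_linearr. Qed.

Definition to_tens : {linear tens (rest P) (rest V) -> rest (tens P V)} :=
  @tens_lin A (rest P) (rest V) (rest (tens P V)) (fun u v => pure (u : P) (v : V))
    to_tens_bl to_tens_br.

Lemma to_tensE (u : P) (v : V) : to_tens (pure (u : rest P) (v : rest V)) = pure u v.
Proof. exact: tens_linE. Qed.

Lemma killed_tens : killed I (tens (rest P) (rest V)).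
Proof.
move=> a t Ia; elim/tens_ind: t => [|t t' It It'|r v]; first exact: scaler0.
  by rewrite scalerDr It It' addr0.
transitivity (pure r (a *: v)); first exact/esym/pureZr.
by rewrite killed_rest // pure0r.
Qed.

Fact of_tens_bl (v : V) : linear (fun u : P => pure (u : rest P) (v : rest V) : low killed_tens).
Proof.
elim/quotr_ind=> a u w; rewrite [_ *: (_ : low _)]low_scaleE.
exact: (pure_linearl (v : rest V) a (u : rest P)).
Qed.
Fact of_tens_br (u : P) : linear (fun v : V => pure (u : rest P) (v : rest V) : low killed_tens).
Proof.
elim/quotr_ind=> a v w; rewrite [_ *: (_ : low _)]low_scaleE.
exact: (pure_linearr (u : rest P) a (v : rest V)).
Qed.

Definition of_tens : {linear tens P V -> low killed_tens} :=
  @tens_lin B P V (low killed_tens) (fun u v => pure (u : rest P) (v : rest V))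
    of_tens_bl of_tens_br.

Lemma of_tensE (u : P) (v : V) : of_tens (pure u v) = pure (u : rest P) (v : rest V).
Proof. exact: tens_linE. Qed.

(** Through this identity [tens_ex_restc] carries a primitive found over A back to B. *)
Lemma of_tensK t : to_tens (of_tens t) = t.
Proof.
elim/tens_ind: t => [|t t' It It'|u v].
- by rewrite raddf0; exact: (raddf0 to_tens).
- by rewrite raddfD -[in RHS]It -[in RHS]It'; exact: (raddfD to_tens).
- by rewrite of_tensE; exact: to_tensE.
Qed.

End Tensor.

Lemma to_tens_map (P P' V : lmodType B) (f : {linear P -> P'}) t :
  to_tens P' V (tens_map (rest V) (rest_map f) t) = tens_map V f (to_tens P V t).
Proof.
apply: (tens_ext (h := to_tens P' V \o tens_map (rest V) (rest_map f))
  (k := rest_map (tens_map V f) \o to_tens P V)) => u v.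
rewrite [LHS](congr1 (to_tens P' V) (tens_mapE _ _ _)) [LHS]to_tensE.
rewrite [RHS](congr1 (tens_map V f) (to_tensE _ _)).
exact/esym/tens_mapE.
Qed.

Lemma of_tens_map (P P' V : lmodType B) (f : {linear P -> P'}) (t : tens P V) :
  of_tens P' V (tens_map V f t) = tens_map (rest V) (rest_map f) (of_tens P V t).
Proof.
have lD := raddfD (tens_map (rest V) (rest_map f)).
elim/tens_ind: t => [|t t' It It'|u v].
- by rewrite !raddf0.
- by rewrite raddfD [LHS](raddfD (of_tens P' V)) [X in X + _]It [X in _ + X]It' raddfD [RHS]lD.
rewrite [tens_map V f _]tens_mapE [LHS]of_tensE.
rewrite [RHS](congr1 (tens_map _ (rest_map f)) (of_tensE _ _)).
exact/esym/tens_mapE.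
Qed.

End ChangeOfRings.

(** * Standard resolutions *)

Section ModuleComplex.
Variable A : pzRingType.

Definition modc_obj (M : lmodType A) i : lmodType A := if i is 1%N then M else zerom A.

Fact modc_obj0 M (x : modc_obj M 0%N) : x = 0. Proof. exact: zeromE. Qed.

Definition modc (M : lmodType A) : cplx A :=
  @Cplx _ (modc_obj M) (fun=> \0) (fun _ _ => erefl) (@modc_obj0 M).

Definition modc_fun (M N : lmodType A) (f : {linear M -> N}) i :
    {linear modc M i -> modc N i} :=
  match i with 1%N => f | _ => \0 end.

Fact modc_chain (M N : lmodType A) (f : {linear M -> N}) i x :
  dif (modc N) i (modc_fun f i.+1 x) = modc_fun f i (dif (modc M) i x).
Proof. by rewrite raddf0. Qed.

Definition modc_map (M N : lmodType A) (f : {linear M -> N}) : chmap (modc M) (modc N) :=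
  Chmap (modc_chain f).

Lemma modc_ses (M' M M'' : lmodType A) (i : {linear M' -> M}) (p : {linear M -> M''}) :
  injective i -> (forall y, exists x, p x = y) -> (forall x, p (i x) = 0) ->
  (forall x, p x = 0 -> exists x', i x' = x) ->
  [/\ forall n, injective (modc_map i n),
      forall n y, exists x, modc_map p n x = y,
      forall n x, modc_map p n (modc_map i n x) = 0 &
      forall n x, modc_map p n x = 0 -> exists x', modc_map i n x' = x].
Proof.
move=> i_inj p_surj pi0 ip; split=> -[|[|n]] //=.
- by move=> x y _; rewrite (zeromE x) (zeromE y).
- by move=> x y _; rewrite (zeromE x) (zeromE y).
- by move=> y; exists 0; rewrite (zeromE y).
- by move=> y; exists 0; rewrite (zeromE y).
- by move=> x _; exists 0; rewrite (zeromE x).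
- by move=> x _; exists 0; rewrite (zeromE x).
Qed.

Section Augmented.
Variables (C : cplx A) (M : lmodType A) (e : {linear C 1%N -> M}).
Hypothesis e_surj : forall m, exists c, e c = m.
Hypothesis ed : forall c, e (dif C 1%N c) = 0.
Hypothesis e_ker : forall c, e c = 0 -> exists b, dif C 1%N b = c.
Hypothesis exC : forall i, ex_at C i.+1.

Definition aug_fun i : {linear C i -> modc M i} :=
  match i with 1%N => e | _ => \0 end.

Fact aug_chain i c : dif (modc M) i (aug_fun i.+1 c) = aug_fun i (dif C i c).
Proof. by case: i c => [|[|i]] c //=; rewrite ed. Qed.

Definition augc : chmap C (modc M) := Chmap aug_chain.

Lemma ex_augc i : ex_at (cone augc) i.
Proof.
(* The cases use in turn that e is onto, that its kernel consists of boundaries, and that C is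
   exact. In the last two, -b absorbs the sign in [shift]. *)
case: i => [|[|i]] [y c] /pair_equal_spec[/= yc dc].
- have [b bE] := e_surj y; exists (0, b); congr pair; first by rewrite /= add0r.
  by rewrite [LHS](obj0 (c := C)) [RHS](obj0 (c := C)).
- rewrite add0r in yc; have [b bE] := e_ker yc.
  by exists (0, - b); congr pair; [rewrite [LHS]zeromE [RHS]zeromE|rewrite /= raddfN opprK].
have [|b bE] := exC (c := c); first by apply/eqP; rewrite -oppr_eq0; apply/eqP.
by exists (0, - b); congr pair; [rewrite [LHS]zeromE [RHS]zeromE|rewrite /= raddfN opprK].
Qed.

End Augmented.

Section StandardResolution.
Variable M : lmodType A.

Definition resc_obj i : lmodType A := if i is j.+1 then res M j else zerom A.

Definition resc_dif i : {linear resc_obj i.+1 -> resc_obj i} :=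
  match i with 0%N => \0 | j.+1 => res_d M j end.

Lemma res_dK i x : res_d M i (res_d M i.+1 x) = 0.
Proof. by apply/eqP; rewrite -[_ == 0]/(_ \in kerm (res_d M i)) res_exact; apply/asboolP; exists x. Qed.

Fact resc_difK i x : resc_dif i (resc_dif i.+1 x) = 0.
Proof. by case: i x => [|i] x //=; exact: res_dK. Qed.

Definition resc : cplx A := Cplx resc_difK (@zeromE A).

Lemma aug_res_d x : aug M (res_d M 0%N x) = 0.
Proof. by apply/eqP; rewrite -[_ == 0]/(_ \in kerm (aug (syzygy M 0))) -imm_res_d; apply/asboolP; exists x. Qed.

Lemma aug_ker c : aug M c = 0 -> exists b, res_d M 0%N b = c.
Proof. by move=> /eqP c0; apply/asboolP; rewrite -[asbool _]/(_ \in imm (res_d M 0)) imm_res_d. Qed.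

Lemma res_ker i c : res_d M i c = 0 -> exists b, res_d M i.+1 b = c.
Proof. by move=> /eqP c0; apply/asboolP; rewrite -[asbool _]/(_ \in imm (res_d M i.+1)) -res_exact. Qed.

End StandardResolution.

Lemma homology_zero (U V W : lmodType A) (f : {linear U -> V}) (g : {linear V -> W}) :
  is_zero_module (homology f g) <-> forall v, g v = 0 -> exists u, f u = v.
Proof.
split=> [h v gv|h]; last first.
  elim/quotm_ind=> v; apply/quotm_pi_eq0.
  by apply/asboolP; apply: h; exact/eqP/(valP v).
have kv : v \in kerm g by apply/eqP.
have /quotm_pi_eq0 := h (quotm_pi (imker f g) (exist _ v kv)).
exact: asboolW.
Qed.

Lemma quotm_zero (U V : lmodType A) (f : {linear U -> V}) :
  is_zero_module (quotm (imm f)) <-> forall v, exists u, f u = v.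
Proof.
split=> [h v|h]; first by have /quotm_pi_eq0/asboolP := h (quotm_pi (imm f) v).
by elim/quotm_ind=> v; apply/quotm_pi_eq0/asboolP/h.
Qed.

Lemma subm_zero (U V : lmodType A) (f : {linear U -> V}) :
  is_zero_module (subm (kerm f)) <-> forall u, f u = 0 -> u = 0.
Proof.
split=> [h u /eqP fu|h u]; last by apply/val_inj/h/eqP/(valP u).
by have /(congr1 val) := h (exist _ u fu).
Qed.

End ModuleComplex.

Section TorExtExactness.
Variables (A : comPzRingType) (M N : lmodType A).

(** The indices agree without shift: at 0 a primitive is defined on [resc M 0], which is zero, so
    exactness there says that the kernel defining Ext^0 vanishes. *)
Lemma Ext_hom_ex : (forall i, is_zero_module (Ext i M N)) <->
  (forall i, hom_ex N (resc M) i).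
Proof.
have hommP (P : lmodType A) (f : {linear P -> N}) : (f : P -> N) \in homm_sub P N.
  by apply/asboolP; exact: linearP.
pose mk (P : lmodType A) (f : {linear P -> N}) : homm P N :=
  exist (fun h => h \in homm_sub P N) _ (hommP P f).
split=> h [|i].
- move=> f fd; exists \0 => x; have /subm_zero h0 := h 0%N.
  have fd0 : homm_map N (res_d M 0) (mk _ f) = 0.
    by apply: val_inj; apply: funext => y; exact: fd.
  by have /(congr1 val)/(congr1 (@^~ x)) := h0 _ fd0.
- move=> f fd; have /homology_zero hi := h i.+1.
  have [|g gE] := hi (mk _ f); first by apply: val_inj; apply: funext => y; exact: fd.
  exists (lin_of (asboolW (valP g))) => x.
  by have /(congr1 val)/(congr1 (@^~ x))/esym := gE.
- apply/subm_zero => f fd.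
  have [|g gE] := h 0%N (lin_of (asboolW (valP f))).
    by move=> x; have /(congr1 val)/(congr1 (@^~ x)) := fd.
  apply: val_inj; apply: funext => x; rewrite [LHS]gE; exact: raddf0.
apply/homology_zero => f fd.
have [|g gE] := h i.+1 (lin_of (asboolW (valP f))).
  by move=> x; have /(congr1 val)/(congr1 (@^~ x)) := fd.
exists (mk _ g); apply: val_inj; apply: funext => x; exact/esym/gE.
Qed.

Lemma Tor_tens_ex : (forall i, is_zero_module (Tor i M N)) <->
  (forall i, tens_ex N (resc M) i).
Proof.
split=> h [|i].
- by move=> t _; have /quotm_zero := h 0%N; exact.
- by move=> t dt; have /homology_zero := h i.+1; exact.
- by apply/quotm_zero => t; apply: (h 0%N); exact: (@tensc_obj0 _ (resc M)).
- by apply/homology_zero => t dt; exact: (h i.+1).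
Qed.

End TorExtExactness.

(** * Regular sequences *)

Section RegularSequence.
Variables (A : comPzRingType) (x : seq A) (M : lmodType A).

Definition modseq j : lmodType A := quotm (idealm (ideal (take j x)) M).

Fact mulm_linear (X : lmodType A) (a : A) : linear (fun m : X => a *: m).
Proof. by move=> b u v; rewrite scalerDr !scalerA mulrC. Qed.

Definition mulm (X : lmodType A) (a : A) : {linear X -> X} := lin_of (mulm_linear a).

Lemma idealm_nil v : v \in idealm (ideal (take 0 x)) M -> v = 0.
Proof.
rewrite take0 => /asboolW Iv; apply/eqP.
apply: (Iv (kerm (idfun : {linear M -> M}))) => _ [a [m [/asboolW Ia ->]]].
have : (a : A^o) \in kerm (idfun : {linear A^o -> A^o}) by apply: Ia.
by move=> /eqP /= ->; apply/eqP; exact: scale0r.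
Qed.

(** This is the right exact part of multiplication by x_j on M/(x_1, ..., x_(j-1))M; injectivity on
    the left is the regularity hypothesis. *)
Lemma modseq_step j : (j < size x)%N -> exists p : {linear modseq j -> modseq j.+1},
  [/\ forall y, exists m, p m = y, forall m, p (mulm _ x`_j m) = 0 &
      forall m, p m = 0 -> exists m', mulm _ x`_j m' = m].
Proof.
move=> jx; have tE := take_nth 0 jx.
have sub v : v \in idealm (ideal (take j x)) M ->
    quotm_pi (idealm (ideal (take j.+1 x)) M) v = 0.
  move=> /asboolW Iv; apply/quotm_pi_eq0/Iv => _ [a [m [/asboolW Ia ->]]].
  apply: genm_sub; exists a, m; split=> //; apply: Ia => b bx.
  by apply: genm_sub; rewrite tE mem_rcons inE bx orbT.
exists (quotm_lift sub); split.
- by elim/quotm_ind=> v; exists (quotm_pi _ v); exact: quotm_liftE.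
- elim/quotm_ind=> v.
  rewrite [X in quotm_lift _ X](esym (quotm_piZ _ _ _)) quotm_liftE.
  apply/quotm_pi_eq0/genm_sub; exists x`_j, v; split=> //.
  by apply: genm_sub; rewrite tE mem_rcons inE eqxx.
elim/quotm_ind=> v; rewrite quotm_liftE => /quotm_pi_eq0/asboolW Iv.
(* The projection of M onto the cokernel of multiplication by
   [x]_j[. It kills b m for each b in]take j.+1 x[, since b is either]x[_j] or an entry of
   [take j x]. *)
pose c : {linear M -> _} := quotm_pi (imm (mulm _ x`_j)) \o quotm_pi (idealm (ideal (take j x)) M).
suff /eqP/quotm_pi_eq0/asboolP : v \in kerm c by [].
apply: Iv => _ [a [m [/asboolW Ia ->]]].
have ml : linear (fun b : A^o => b *: m) by move=> b u w; rewrite scalerDl scalerA.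
apply: (Ia (kerm (c \o lin_of ml))) => b.
rewrite tE mem_rcons inE => /orP[/eqP -> | bx]; apply/eqP.
  apply/quotm_pi_eq0/asboolP; exists (quotm_pi _ m); exact/esym/quotm_piZ.
rewrite /= [quotm_pi (idealm _ _) _](_ : _ = 0) ?quotm_pi0 //.
by apply/quotm_pi_eq0/genm_sub; exists b, m; split=> //; apply: genm_sub.
Qed.

End RegularSequence.

(** * Resolutions over A/I viewed over A *)

Section RestrictedResolution.
Variables (A : comPzRingType) (I : submodClosed A^o).
Notation B := (quotr I).

Fact restc_difK (C : cplx B) i c : rest_map (dif C i) (rest_map (dif C i.+1) c) = 0.
Proof. exact: (difK (c := C)). Qed.

Fact restc_obj0 (C : cplx B) (c : rest (C 0%N)) : c = 0.
Proof. exact: (obj0 (c := C)). Qed.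

Definition restc (C : cplx B) : cplx A := Cplx (@restc_difK C) (@restc_obj0 C).

(** The two modules share their elements, but the A-action on the left passes through A/I, so
    linearity of the identity needs a proof. *)
Fact unred_linear (M : lmodType A) :
  linear (fun q : rest (redm I M) => q : quotm (idealm I M)).
Proof.
move=> a; elim/redm_ind=> u v; rewrite rest_scaleE.
by rewrite [_ *: redm_pi _ _]redm_scaleE; congr (_ + v); exact: quotm_piZ.
Qed.

Definition unred (M : lmodType A) : {linear rest (redm I M) -> quotm (idealm I M)} :=
  lin_of (@unred_linear M).

Fact red_linear (M : lmodType A) :
  linear (fun q : quotm (idealm I M) => q : rest (redm I M)).
Proof. by move=> a u v; exact/esym/(linearP (unred M)). Qed.

Definition red (M : lmodType A) : {linear quotm (idealm I M) -> rest (redm I M)} :=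
  lin_of (@red_linear M).

Lemma restc_killed (U : lmodType B) i : killed I (restc (resc U) i).
Proof. exact: killed_rest. Qed.

Lemma restc_projm (U : lmodType B) i : projm (killed I) (restc (resc U) i).
Proof.
case: i => [|i]; last exact: projm_rest_free.
by move=> X Y p f _ _ _; exists \0 => u; rewrite (restc_obj0 (C := resc U) u) !raddf0.
Qed.

Lemma tens_ex_restc (P : cplx B) (V : lmodType B) i :
  tens_ex (rest V) (restc P) i -> tens_ex V P i.
Proof.
move=> exP t dt; have [|u uE] := exP (of_tens (P i.+1) V t).
  have E := of_tens_map (dif P i) t.
  by rewrite -[LHS]E [X in of_tens _ _ X]dt raddf0.
exists (to_tens (P i.+2) V u); have E := to_tens_map (dif P i.+1) u.
exact: (etrans (esym E) (etrans (congr1 (to_tens (P i.+1) V) uE) (of_tensK t))).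
Qed.

Lemma hom_ex_restc (P : cplx B) (V : lmodType B) i :
  hom_ex (rest V) (restc P) i -> hom_ex V P i.
Proof.
move=> exP f fd; have [|g gE] := exP (rest_map f); first exact: fd.
by exists (lin_of (unrest_linear g)).
Qed.

(** Let q : L -> M/IM be the augmentation. Its cone is exact and is an extension of [shift L] by
    M/IM, so [null_ses] makes [shift L] null, and [null_test] with k = 0 applies to it. *)
Lemma restc_null (T : exactness_test I) (M : lmodType A) n :
  null T n (modc (quotm (idealm I M))) ->
  forall i, (i < n)%N -> T (restc (resc (redm I M))) i.
Proof.
set L := restc _ => nM i lin.
pose e : {linear L 1%N -> quotm (idealm I M)} := unred M \o rest_map (aug (redm I M)).
have e_surj m : exists c, e c = m by have [c cE] := aug_surj (m : redm I M); exists c.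
have ed c : e (dif L 1%N c) = 0 by exact: (@aug_res_d _ (redm I M) c).
have e_ker c : e c = 0 -> exists b, dif L 1%N b = c by exact: (@aug_ker _ (redm I M) c).
have exL j : ex_at L j.+1 by move=> c; exact: (@res_ker _ (redm I M) j c).
pose q := augc ed.
have exq := ex_augc e_surj e_ker exL : forall j, ex_at (cone q) j.
pose il : chmap (modc (quotm (idealm I M))) (cone q) :=
  @Chmap _ _ (cone q) (fun j => inlm _ _) (fun j y => cone_inlE q y).
pose sn : chmap (cone q) (shift L) := @Chmap _ (cone q) (shift L) (fun j => snd) (fun j c => erefl).
suff nL : null T n.+1 (shift L).
  apply/hx_shift; apply: (null_test (k := 0)) nL _ _ _ => //.
  - by apply: killed_shift => j; exact: restc_killed.
  - by apply: shift_proj => j; exact: restc_projm.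
apply: (@null_ses _ _ T _ _ _ il sn) nM (null_exact _ _ exq).
- by move=> j u v /pair_equal_spec[].
- by move=> j y; exists (0, y).
- by [].
- by move=> j [u v] /= ->; exists u.
Qed.

End RestrictedResolution.

(** Here [ex] stands for [tens_ex] or [hom_ex]. The coefficients N are reduced first, since an
    exactness test is available only for coefficients killed by the ideal; then M is reduced, and
    [restc_null] concludes. *)
Lemma descent (A : comPzRingType) (x : seq A) (M N : lmodType A)
    (ex : lmodType A -> cplx A -> nat -> Prop) :
  (forall (I : submodClosed A^o) V, killed I V -> exists T : exactness_test I, hx T = ex V) ->
  (forall (S : cplx A) (N' N N'' : lmodType A) (i : {linear N' -> N}) (p : {linear N -> N''}),
     (forall j, projective (S j)) -> injective i -> (forall y, exists z, p z = y) ->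
     (forall z, p (i z) = 0) -> (forall z, p z = 0 -> exists z', i z' = z) ->
     (forall j, ex N' S j) -> (forall j, ex N S j) -> forall j, ex N'' S j) ->
  (forall S j, ex (zerom A) S j) ->
  regular_seq M x -> regular_seq N x ->
  (forall i, ex N (resc M) i) ->
  forall i, ex (rest (redm (ideal x) N)) (restc (resc (redm (ideal x) M))) i.
Proof.
move=> exT ex_coef ex0 regM regN exMN.
have pS i : projective (resc M i).
  by case: i => [|i]; [exact: projm_zero|exact: projm_freem].
have zinj (X : lmodType A) : injective (\0 : {linear zerom A -> X}).
  by move=> u v _; rewrite (zeromE u) (zeromE v).
(* Multiplication by x_j is injective on each successive quotient of N, so [ex_coef] applies along
   the sequence. It starts from 0 -> 0 -> N -> N/(0)N -> 0. *)
have exN j : (j <= size x)%N -> forall i, ex (modseq x N j) (resc M) i.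
  elim: j => [_|j IHj jx].
    apply: (ex_coef _ _ _ _ _ (quotm_pi _) pS (zinj N)) => //.
    - by elim/quotm_ind=> v; exists v.
    - by move=> z /quotm_pi_eq0/idealm_nil ->; exists 0.
  have [p [p_surj p0 p_ker]] := modseq_step N jx.
  by apply: (ex_coef _ _ _ _ (mulm _ x`_j) p pS _ p_surj p0 p_ker); [exact: regN|exact/IHj/ltnW..].
have {}exN : forall i, ex (rest (redm (ideal x) N)) (resc M) i.
  have exN1 := exN _ (leqnn _).
  rewrite /modseq take_size in exN1.
  apply: (ex_coef _ _ _ _ _ (red (ideal x) N) pS (zinj _)) => //.
  - by move=> y; exists y.
  - by move=> z z0; exists 0; exact/esym.
have [T TE] := exT (ideal x) _ (@killed_rest _ _ (redm (ideal x) N)).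
(* The same induction for M, with [null_ses] applied to modules placed at index 1; M itself is null
   through its standard resolution. *)
have nM j n : (j <= size x)%N -> null T n (modc (modseq x M j)).
  have zex i : ex_at (modc (zerom A)) i.
    by move=> c _; exists 0; case: i c => [|[|i]] c; rewrite [LHS]zeromE [RHS]zeromE.
  elim: j n => [|j IHj] n jx; apply: (null_le (leqnSn n)).
    have [i1 i2 i3 i4] := @modc_ses _ (zerom A) M (modseq x M 0) \0 (quotm_pi _) (zinj _)
      (@quotm_ind _ _ _ _ (fun v => ex_intro _ v erefl)) (fun=> quotm_pi0 _)
      (fun v v0 => ex_intro _ 0 (esym (idealm_nil (iffLR (quotm_pi_eq0 _ _) v0)))).
    apply: (null_ses i1 i2 i3 i4); first exact: null_exact.
    exists (resc M), (augc (C := resc M) (e := aug M) (@aug_res_d _ M)); split=> //.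
      apply: ex_augc; [exact: aug_surj|exact: aug_ker|].
      by move=> i c; exact: res_ker.
    by move=> i _; rewrite TE.
  have [p [p_surj p0 p_ker]] := modseq_step M jx.
  have [i1 i2 i3 i4] := modc_ses (regM _ jx : injective (mulm _ x`_j)) p_surj p0 p_ker.
  by apply: (null_ses i1 i2 i3 i4); exact/IHj/ltnW.
move=> i; rewrite -TE; apply: (restc_null (n := i.+1)) => //.
by have := nM _ i.+1 (leqnn _); rewrite /modseq take_size.
Qed.

Theorem corollary2 (A : comPzRingType) (hA : noetherian A) (x : seq A)
    (M N : lmodType A) (hM : regular_seq M x) (hN : regular_seq N x) :
  ((forall i : nat, is_zero_module (Tor i M N)) ->
   forall i : nat,
     is_zero_module (@Tor (quotr (ideal x)) i
         (redm (ideal x) M) (redm (ideal x) N))) /\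
  ((forall i : nat, is_zero_module (Ext i M N)) ->
   forall i : nat,
     is_zero_module (@Ext (quotr (ideal x)) i
         (redm (ideal x) M) (redm (ideal x) N))).
Proof.
split=> [/Tor_tens_ex MN0|/Ext_hom_ex MN0].
  apply/Tor_tens_ex => i; apply: tens_ex_restc; move: i.
  apply: (descent (ex := @tens_ex A) _ _ _ hM hN MN0).
  - by move=> I V KV; exists (tensor_test KV).
  - by move=> S N1 N2 N3 j p pS jI pS' pj kerp; exact: (tens_ex_coef pS jI pS' pj kerp).
  - move=> S j s _; exists 0; rewrite raddf0; elim/tens_ind: s => [//|s s' <- <-|r v].
      by rewrite addr0.
    by rewrite (zeromE v) pure0r.
apply/Ext_hom_ex => i; apply: hom_ex_restc; move: i.
apply: (descent (ex := @hom_ex A) _ _ _ hM hN MN0).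
- by move=> I V KV; exists (hom_test KV).
- by move=> S N1 N2 N3 j p pS jI pS' pj kerp; exact: (hom_ex_coef pS jI pS' pj kerp).
- by move=> S j k _; exists \0 => s; rewrite [LHS]zeromE.
Qed.
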